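(* Let $A$ be a bounded double complex over a field with $H_{BC}^{p,q}(A)$ and $H_A^{p,q}(A)$ finite dimensional for all $p,q\in\mathbb{Z}$. Then $$\Delta^k(A)\ge0\qquad\text{for all }k\in\mathbb{Z},$$ and equality holds for all $k$ if and only if $A$ satisfies the $\partial_1\partial_2$-lemma.
   Context: A double complex over a field $K$ is a bigraded $K$-vector space $A=\bigoplus_{p,q\in\mathbb{Z}}A^{p,q}$ with endomorphisms $\partial_1,\partial_2$ of bidegree $(1,0)$ and $(0,1)$ satisfying $\partial_1^2=\partial_2^2=0$ and $\partial_1\partial_2+\partial_2\partial_1=0$. It is bounded if $A^{p,q}=0$ for all but finitely many $(p,q)$. Set $H_{BC}^{p,q}(A)=\left(\frac{\ker\partial_1\cap\ker\partial_2}{\operatorname{im}\partial_1\partial_2}\right)^{p,q}$, $H_A^{p,q}(A)=\left(\frac{\ker\partial_1\partial_2}{\operatorname{im}\partial_1+\operatorname{im}\partial_2}\right)^{p,q}$, and let $H_{dR}^k(A)$ be the cohomology of the total complex $\bigoplus_{p+q=k}A^{p,q}$ with differential $\partial_1+\partial_2$ (it is finite dimensional under the hypotheses). The non-$\partial_1\partial_2$-degrees are $$\Delta^k(A)=\sum_{p+q=k}\big(\dim H_{BC}^{p,q}(A)+\dim H_A^{p,q}(A)\big)-2\dim H_{dR}^k(A).$$ $A$ satisfies the $\partial_1\partial_2$-lemma if the natural map $H_{BC}^{p,q}(A)\to H_A^{p,q}(A)$ is injective for all $(p,q)\in\mathbb{Z}^2$. *)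

(* Defs.v *)
From HB Require Import structures.
From mathcomp Require Import all_boot all_order all_algebra.
From mathcomp Require Import all_classical.

Set Implicit Arguments.
Unset Strict Implicit.
Unset Printing Implicit Defensive.

Import Order.TTheory GRing.Theory Num.Theory.
Local Open Scope classical_set_scope.
Local Open Scope ring_scope.
Local Open Scope quotient_scope.

Section Subspaces.
Variables (K : fieldType) (V W : lmodType K).

Definition kerS (f : {linear V -> W}) : {pred V} := [pred x | f x == 0].

Definition imS (f : {linear V -> W}) (S : submodClosed V) : {pred W} :=
  [pred y | `[< exists2 x, x \in S & y = f x >]].

Definition capS (S T : submodClosed V) : {pred V} :=
  [pred x | (x \in S) && (x \in T)].

Definition addS (S T : submodClosed V) : {pred V} :=
  [pred x | `[< exists y z, [/\ y \in S, z \in T & x = y + z] >]].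

Definition fullS : {pred V} := [pred x | true].

Fact kerS_closed f : subsemimod_closed (kerS f).
Proof.
split; first split.
- by rewrite inE raddf0.
- by move=> x y; rewrite !inE => /eqP fx /eqP fy; rewrite raddfD /= fx fy addr0.
- by move=> a x; rewrite !inE => /eqP fx; rewrite linearZ /= fx scaler0.
Qed.

Fact imS_closed f S : subsemimod_closed (imS f S).
Proof.
split; first split.
- by apply/asboolP; exists 0; rewrite ?rpred0 ?raddf0.
- move=> x y /asboolP[u uS ->] /asboolP[v vS ->]; apply/asboolP.
  by exists (u + v); rewrite ?rpredD ?raddfD.
- move=> a x /asboolP[u uS ->]; apply/asboolP.
  by exists (a *: u); rewrite ?rpredZ ?linearZ.
Qed.

Fact capS_closed S T : subsemimod_closed (capS S T).
Proof.
split; first split.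
- by rewrite inE !rpred0.
- move=> x y; rewrite !inE => /andP[xS xT] /andP[yS yT].
  by rewrite !rpredD.
- by move=> a x; rewrite !inE => /andP[xS xT]; rewrite !rpredZ.
Qed.

Fact addS_closed S T : subsemimod_closed (addS S T).
Proof.
split; first split.
- by apply/asboolP; exists 0, 0; rewrite !rpred0 addr0.
- move=> x y /asboolP[u [v [uS vT ->]]] /asboolP[u' [v' [uS' vT' ->]]].
  by apply/asboolP; exists (u + u'), (v + v'); rewrite !rpredD // addrACA.
- move=> a x /asboolP[u [v [uS vT ->]]].
  by apply/asboolP; exists (a *: u), (a *: v); rewrite !rpredZ // scalerDr.
Qed.

Fact fullS_closed : subsemimod_closed fullS.
Proof. by []. Qed.

HB.instance Definition _ f :=
  GRing.isSubSemiModClosed.Build K V (kerS f) (kerS_closed f).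
HB.instance Definition _ f S :=
  GRing.isSubSemiModClosed.Build K W (imS f S) (imS_closed f S).
HB.instance Definition _ S T :=
  GRing.isSubSemiModClosed.Build K V (capS S T) (capS_closed S T).
HB.instance Definition _ S T :=
  GRing.isSubSemiModClosed.Build K V (addS S T) (addS_closed S T).
HB.instance Definition _ :=
  GRing.isSubSemiModClosed.Build K V fullS fullS_closed.

End Subspaces.

Arguments fullS {K} V _.

Section Subquotient.
Variables (K : fieldType) (V : lmodType K).

Record subsp (Z : submodClosed V) := Subsp {
  subsp_val :> V;
  subsp_valP : subsp_val \in Z }.

HB.instance Definition _ Z := [isSub for @subsp_val Z].
HB.instance Definition _ Z := [Choice of subsp Z by <:].
HB.instance Definition _ Z := [SubChoice_isSubLmodule of subsp Z by <:].

Variables Z B : submodClosed V.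

Definition restrS : {pred subsp Z} := [pred x | val x \in B].

Fact restrS_closed : submod_closed restrS.
Proof.
split=> [|a x y]; rewrite !inE ?raddf0 ?rpred0 // => xB yB.
by rewrite linearP /= rpredD ?rpredZ.
Qed.

HB.instance Definition _ :=
  GRing.isSubmodClosed.Build K (subsp Z) restrS restrS_closed.

(* Z / (Z :&: B); B need not be contained in Z. *)
Definition subquot := Quotient.quot restrS.

HB.instance Definition _ := Choice.on subquot.
HB.instance Definition _ :=
  EqQuotient.copy subquot (Quotient.quot restrS).
HB.instance Definition _ := GRing.Zmodule.on subquot.

Definition cls (x : subsp Z) : subquot := \pi x.

Lemma clsE x y : (cls x = cls y) <-> (val x - val y \in B).
Proof.
rewrite -[val x - val y]/(val (x - y)) -[_ \in B]/(x - y \in restrS).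
by rewrite Quotient.idealrBE; split => [|/eqP] // e; apply/eqP.
Qed.

Lemma clsD x y : cls (x + y) = cls x + cls y.
Proof. exact: raddfD. Qed.

Lemma cls_repr (u : subquot) : cls (repr u) = u.
Proof. exact: reprK. Qed.

Definition scaleq (a : K) (u : subquot) : subquot := cls (a *: repr u).

Lemma scaleqE a x : scaleq a (cls x) = cls (a *: x).
Proof.
apply/clsE; rewrite -[val _ - _]/(a *: val (repr (cls x)) - a *: val x).
by rewrite -scalerBr rpredZ //; apply/clsE/cls_repr.
Qed.

Fact scaleqA a b u : scaleq a (scaleq b u) = scaleq (a * b) u.
Proof. by rewrite -(cls_repr u) !scaleqE scalerA. Qed.

Fact scale1q : left_id 1 scaleq.
Proof. by move=> u; rewrite -(cls_repr u) scaleqE scale1r. Qed.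

Fact scaleqDr : right_distributive scaleq +%R.
Proof.
move=> a u v; rewrite -(cls_repr u) -(cls_repr v).
by rewrite -clsD !scaleqE -clsD scalerDr.
Qed.

Fact scaleqDl u : {morph scaleq^~ u : a b / a + b}.
Proof. by move=> a b; rewrite -(cls_repr u) !scaleqE scalerDl clsD. Qed.

HB.instance Definition _ := GRing.Zmodule_isLmodule.Build K subquot
  scaleqA scale1q scaleqDr scaleqDl.

Fact cls_linear : linear cls.
Proof. by move=> a x y; rewrite clsD -scaleqE. Qed.

HB.instance Definition _ :=
  GRing.isLinear.Build K (subsp Z) subquot _ cls cls_linear.

End Subquotient.

Section InducedMap.
Variables (K : fieldType) (V : lmodType K) (Z B Z' B' : submodClosed V).
Hypothesis sZ : {subset Z <= Z'}.

Definition incl (x : subsp Z) : subsp Z' := Subsp (sZ (valP x)).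

(* The map Z / B -> Z' / B' sending the class of x to the class of x; it does
   not depend on the representatives when B is contained in B' (induced_cls). *)
Definition induced (u : subquot Z B) : subquot Z' B' := cls B' (incl (repr u)).

Lemma induced_cls x : {subset B <= B'} -> induced (cls B x) = cls B' (incl x).
Proof.
move=> sB; apply/clsE/sB.
exact: (clsE B (repr (cls B x)) x).1 (cls_repr (cls B x)).
Qed.

End InducedMap.

Section Dimension.
Variable (K : fieldType).

Definition has_dim (V : lmodType K) (n : nat) := inhabited (Vector.axiom n V).

Definition fin_dim (V : lmodType K) := exists n, has_dim V n.

(* 0 when V is not finite dimensional. *)
Definition dim (V : lmodType K) : nat := xget 0%N [set n | has_dim V n].

Lemma has_dim_unique (V : lmodType K) m n :
  has_dim V m -> has_dim V n -> m = n.
Proof.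
wlog suff le_mn : m n / has_dim V m -> has_dim V n -> (m <= n)%N.
  by move=> hm hn; apply/eqP; rewrite eqn_leq !le_mn.
move=> [[f lf [f' fK f'K]]] [[g lg [g' gK g'K]]].
have lf' : linear f'.
  by move=> a x y; apply: (can_inj fK); rewrite lf !f'K.
have lh : linear (g \o f') by move=> a x y /=; rewrite lf' lg.
pose h : {linear 'rV[K]_m -> 'rV[K]_n} :=
  HB.pack (g \o f') (GRing.isLinear.Build _ _ _ _ _ lh).
have : row_free (lin1_mx h).
  apply: inj_row_free => v; rewrite mul_rV_lin1 => hv0.
  apply/(can_inj f'K)/(can_inj gK).
  by apply: (etrans hv0); rewrite -(linear0 h).
by rewrite /row_free => /eqP <-; exact: rank_leq_col.
Qed.

Lemma dimE (V : lmodType K) n : has_dim V n -> dim V = n.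
Proof.
move=> hn; apply: has_dim_unique (hn).
exact: (xgetPex 0%N (ex_intro _ n hn)).
Qed.

End Dimension.

(* The bigrading is internal: A is the total space, part A p q is A^{p,q}. *)
Record double_complex (K : fieldType) := DoubleComplex {
  carrier :> lmodType K;
  part : int -> int -> submodClosed carrier;
  part_direct : forall x : carrier, exists! f : int * int -> carrier,
    [/\ forall pq, f pq \in part pq.1 pq.2,
        finite_set [set pq | f pq != 0]
      & x = \sum_(pq \in [set: int * int]) f pq];
  del1 : {linear carrier -> carrier};
  del2 : {linear carrier -> carrier};
  del1_part : forall p q x, x \in part p q -> del1 x \in part (p + 1) q;
  del2_part : forall p q x, x \in part p q -> del2 x \in part p (q + 1);
  del1_del1 : forall x, del1 (del1 x) = 0;
  del2_del2 : forall x, del2 (del2 x) = 0;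
  del1_del2 : forall x, del1 (del2 x) + del2 (del1 x) = 0 }.

Section Cohomology.
Variables (K : fieldType) (A : double_complex K).

Local Notation d1 := (@del1 K A).
Local Notation d2 := (@del2 K A).

Definition bounded := finite_set
  [set pq : int * int | exists2 x, x \in part A pq.1 pq.2 & x != 0].

(* The boundary spaces of H_BC and H_A are not cut down to bidegree (p, q):
   subquot intersects them with the cycles, which are. *)
Definition BC_cycles p q : submodClosed A :=
  capS (part A p q) (capS (kerS d1) (kerS d2)).
Definition BC_boundaries : submodClosed A := imS (d1 \o d2) (fullS A).
Definition H_BC p q : lmodType K := subquot (BC_cycles p q) BC_boundaries.

Definition A_cycles p q : submodClosed A :=
  capS (part A p q) (kerS (d1 \o d2)).
Definition A_boundaries : submodClosed A :=
  addS (imS d1 (fullS A)) (imS d2 (fullS A)).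
Definition H_A p q : lmodType K := subquot (A_cycles p q) A_boundaries.

(* The finite sums of homogeneous elements of total degree k. *)
Definition total k : {pred A} := [pred x | `[< exists2 s : seq A,
  forall y, y \in s -> exists p q, p + q = k /\ y \in part A p q
  & x = \sum_(y <- s) y >]].

Fact total_closed k : subsemimod_closed (total k).
Proof.
split; first split.
- by apply/asboolP; exists [::]; rewrite ?big_nil.
- move=> x y /asboolP[s sP ->] /asboolP[t tP ->]; apply/asboolP.
  exists (s ++ t); last by rewrite big_cat.
  by move=> z; rewrite mem_cat => /orP[/sP|/tP].
- move=> a x /asboolP[s sP ->]; apply/asboolP.
  exists [seq a *: y | y <- s]; last by rewrite big_map scaler_sumr.
  move=> _ /mapP[y /sP[p [q [pq yA]]] ->].
  by exists p, q; rewrite rpredZ.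
Qed.

HB.instance Definition _ k :=
  GRing.isSubSemiModClosed.Build K A (total k) (total_closed k).

Definition dR_cycles k : submodClosed A := capS (total k) (kerS (d1 \+ d2)).
Definition dR_boundaries k : submodClosed A := imS (d1 \+ d2) (total (k - 1)).
Definition H_dR k : lmodType K := subquot (dR_cycles k) (dR_boundaries k).

(* When A is bounded only finitely many terms of the sum are nonzero; a
   finitely supported sum with infinite support would be 0. *)
Definition Delta (k : int) : int :=
  \sum_(pq \in [set pq : int * int | pq.1 + pq.2 = k])
     ((dim (H_BC pq.1 pq.2))%:Z + (dim (H_A pq.1 pq.2))%:Z)
  - 2 * (dim (H_dR k))%:Z.

Fact BC_A_cycles p q : {subset BC_cycles p q <= A_cycles p q}.
Proof.
move=> x; rewrite !inE => /and3P[-> _ /eqP d2x] /=.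
by rewrite d2x linear0.
Qed.

Fact BC_A_boundaries : {subset BC_boundaries <= A_boundaries}.
Proof.
move=> _ /asboolP[x _ ->]; apply/asboolP; exists (d1 (d2 x)), 0.
by split; rewrite ?rpred0 ?addr0 //; apply/asboolP; exists (d2 x).
Qed.

Definition BC_to_A p q : H_BC p q -> H_A p q :=
  induced A_boundaries (@BC_A_cycles p q).

Lemma BC_to_A_cls p q x :
  @BC_to_A p q (cls BC_boundaries x) =
  cls A_boundaries (incl (@BC_A_cycles p q) x).
Proof. exact/induced_cls/BC_A_boundaries. Qed.

Definition ddlemma := forall p q, injective (@BC_to_A p q).

End Cohomology.

(* Main.v *)
(* Everything is counted in a fixed total degree k, where T_k = total A k, K1, K2,
   K12 are the kernels of d1, d2, d1 d2 in T_k and I1, I2, I12 the images of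
   d1, d2, d1 d2.  Modular-lattice counting between I12 and K12 gives the identity
     h_BC + h_A = h_1 + h_2 + [I1 :&: I2 : I12] + [K12 : K1 + K2],
   where h_i = [Ki : Ii] is the column/row cohomology.  The Froelicher inequality
   b_k <= h_i then gives Delta^k >= 0.  If Delta vanishes, both index terms vanish
   and both spectral sequences degenerate; in particular d1 ker d2 lies in im d2
   and conversely.  A class x = d1 y + d2 z killed by d1 and d2 can then be
   rewritten with y in ker d2 and z in ker d1, so that d1 y and d2 z lie in
   im d1 :&: im d2 = im d1 d2.
   For the converse, the lemma makes H_BC -> H_dR injective and H_dR -> H_A
   surjective in total degree k, so that h_BC + h_A <= 2 b_k. *)

From HB Require Import structures.
Require Import Defs.
From mathcomp Require Import all_boot all_order all_algebra.
From mathcomp Require Import all_classical.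
From mathcomp Require Import zify.

Set Implicit Arguments.
Unset Strict Implicit.
Unset Printing Implicit Defensive.

Import Order.TTheory GRing.Theory Num.Theory.
Local Open Scope ring_scope.

(* [total] is also a predicate on relations in ssrbool. *)
Local Notation total A := (@Defs.total _ A).

(** * Membership in subspaces *)

Lemma memN (K : fieldType) (V : lmodType K) (S : submodClosed V) x :
  (- x \in S) = (x \in S).
Proof. by rewrite -scaleN1r rpredZeq oppr_eq0 oner_eq0. Qed.

Lemma memB (K : fieldType) (V : lmodType K) (S : submodClosed V) x y :
  x \in S -> y \in S -> x - y \in S.
Proof. by move=> xS yS; rewrite rpredD // memN. Qed.

Lemma mem_capS (K : fieldType) (V : lmodType K) (S T : submodClosed V) x :
  (x \in capS S T) = (x \in S) && (x \in T).
Proof. by []. Qed.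

Lemma mem_kerS (K : fieldType) (V W : lmodType K) (f : {linear V -> W}) x :
  (x \in kerS f) = (f x == 0).
Proof. by []. Qed.

Lemma imSP (K : fieldType) (V W : lmodType K) (f : {linear V -> W})
    (S : submodClosed V) y :
  reflect (exists2 x, x \in S & y = f x) (y \in imS f S).
Proof. exact: asboolP. Qed.

Lemma addSP (K : fieldType) (V : lmodType K) (S T : submodClosed V) x :
  reflect (exists y z, [/\ y \in S, z \in T & x = y + z]) (x \in addS S T).
Proof. exact: asboolP. Qed.

(** * Dimensions of subquotients, counted with bases modulo a subspace *)

Section Index.
Variables (K : fieldType).
Implicit Types (V W : lmodType K).

Definition free_mod V (B : submodClosed V) n (v : 'I_n -> V) :=
  forall c : 'I_n -> K, \sum_i c i *: v i \in B -> forall i, c i = 0.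

(** The vectors are representatives in [V] itself, not classes. Subquotients with different [Z] and
    [B] can then be compared without passing between quotient types. *)
Definition basis_mod V (Z B : submodClosed V) n (v : 'I_n -> V) :=
  [/\ forall i, v i \in Z, free_mod B v
    & forall x, x \in Z -> exists c : 'I_n -> K, x - \sum_i c i *: v i \in B].

Lemma cls_eq0 V (Z B : submodClosed V) (x : subsp Z) :
  (cls B x = 0) <-> (val x \in B).
Proof. by rewrite -(linear0 (cls B)) clsE subr0. Qed.

(** Representatives of the classes of the unit row vectors give a basis modulo [B]. Conversely, a
    basis modulo [B] makes the linear combination map from row vectors bijective, and its inverse
    supplies the coordinates. *)
Lemma has_dimP V (Z B : submodClosed V) n :
  has_dim (subquot Z B) n <-> exists v : 'I_n -> V, basis_mod Z B v.
Proof.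
split=> [[[f lf [g fK gK]]]|[v [vZ vfree vspan]]].
  have lg : linear g by move=> a x y; apply: (can_inj fK); rewrite lf !gK.
  pose g' : {linear 'rV[K]_n -> subquot Z B} :=
    HB.pack g (GRing.isLinear.Build _ _ _ _ _ lg).
  pose w i := repr (g (delta_mx 0 i)) : subsp Z.
  have wE (c : 'I_n -> K) : cls B (\sum_i c i *: w i) = g (\row_i c i).
    rewrite linear_sum /= -[g _]/(g' _) [X in g' X]row_sum_delta linear_sum.
    apply: eq_bigr => i _; rewrite !linearZ /= mxE; congr (_ *: _).
    exact: cls_repr.
  have valE (c : 'I_n -> K) :
      val (\sum_i c i *: w i) = \sum_i c i *: val (w i).
    by rewrite raddf_sum.
  exists (fun i => val (w i)); split=> [i|c|x xZ]; first exact: valP.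
    rewrite -valE => /cls_eq0; rewrite wE => gc0 i.
    have : f (g (\row_i c i)) = f (g 0) by rewrite gc0 -(linear0 g').
    by rewrite !gK => /rowP/(_ i); rewrite !mxE.
  exists (fun i => f (cls B (Subsp xZ)) 0 i).
  rewrite -valE.
  apply: (clsE B (Subsp xZ) _).1; rewrite wE -[LHS]fK; congr g.
  by apply/rowP => i; rewrite mxE.
pose w i := Subsp (vZ i).
pose g (r : 'rV[K]_n) := cls B (\sum_i r 0 i *: w i).
have valE (c : 'I_n -> K) : val (\sum_i c i *: w i) = \sum_i c i *: v i.
  by rewrite raddf_sum.
have lg : linear g.
  move=> a x y; rewrite /g -linearP; congr cls.
  rewrite scaler_sumr -big_split; apply: eq_bigr => i _ /=.
  by rewrite !mxE scalerDl scalerA.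
have gsurj u : exists r, g r = u.
  rewrite -(cls_repr u); have [c cP] := vspan _ (valP (repr u)).
  exists (\row_i c i); apply/clsE; rewrite -opprB memN valE.
  by under [X in _ - X]eq_bigr do rewrite mxE.
have [f fP] := choice gsurj.
have ginj : injective g.
  move=> r s /clsE; rewrite !valE -sumrB => rs; apply/rowP => i.
  apply/subr0_eq.
  apply: (vfree (fun i => r 0 i - s 0 i)).
  by under eq_bigr do rewrite scalerBl.
have gK : cancel g f by move=> r; apply: ginj; rewrite fP.
split; exists f; last by exists g.
by move=> a x y; apply: ginj; rewrite fP lg !fP.
Qed.

(* As for [subquot], B need not be contained in Z. *)
Definition fin V (Z B : submodClosed V) := fin_dim (subquot Z B).
Definition dq V (Z B : submodClosed V) : nat := Defs.dim (subquot Z B).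

Lemma finE V (Z B : submodClosed V) :
  fin Z B -> exists v : 'I_(dq Z B) -> V, basis_mod Z B v.
Proof. by case=> n hn; apply/has_dimP; rewrite /dq (dimE hn). Qed.

Lemma dqE V (Z B : submodClosed V) n (v : 'I_n -> V) :
  basis_mod Z B v -> fin Z B /\ dq Z B = n.
Proof.
move=> bv; have hn : has_dim (subquot Z B) n by apply/has_dimP; exists v.
by split; [exists n | exact: dimE].
Qed.

(** The matrix expressing [w] in a basis modulo [B] has independent rows: a relation between rows
    would put a combination of the [w i] into [B]. *)
Lemma free_mod_le V (Z B : submodClosed V) m (w : 'I_m -> V) :
  fin Z B -> (forall i, w i \in Z) -> free_mod B w -> (m <= dq Z B)%N.
Proof.
move=> /finE[v [_ _ vspan]] wZ wfree.
have [C CP] := choice (fun i => vspan _ (wZ i)).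
have : row_free (\matrix_(i, j) C i j).
  apply: inj_row_free => r rC; apply/rowP => i; rewrite mxE.
  apply: (wfree (fun i => r 0 i)).
  have -> : \sum_i r 0 i *: w i =
      \sum_i r 0 i *: (w i - \sum_j C i j *: v j).
    under [RHS]eq_bigr do rewrite scalerBr.
    rewrite sumrB [X in _ - X](_ : _ = 0) ?subr0 //.
    under eq_bigr do rewrite scaler_sumr.
    rewrite exchange_big big1 // => j _ /=.
    under eq_bigr do rewrite scalerA.
    rewrite -scaler_suml [X in X *: _](_ : _ = 0) ?scale0r //.
    move/rowP: rC => /(_ j); rewrite !mxE => rC0.
    by rewrite -[RHS]rC0; apply: eq_bigr => k _; rewrite mxE.
  by apply: rpred_sum => k _; rewrite rpredZ.
by rewrite /row_free => /eqP <-; exact: rank_leq_col.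
Qed.

(** A free family of maximal length spans modulo [B]: a vector outside its span could be added,
    since a nonzero coefficient in front of it could be inverted. *)
Lemma fin_bounded V (Z B : submodClosed V) n :
  (forall m (w : 'I_m -> V),
     (forall i, w i \in Z) -> free_mod B w -> (m <= n)%N) ->
  fin Z B /\ (dq Z B <= n)%N.
Proof.
move=> bnd.
pose P m := `[< exists w : 'I_m -> V, (forall i, w i \in Z) /\ free_mod B w >].
have exP : exists m, P m.
  exists 0%N; apply/asboolP; exists (fun i => 0).
  by split=> [i|c _ []]; first exact: rpred0.
have Pn m : P m -> (m <= n)%N by move=> /asboolP[w [wZ wf]]; exact: bnd wf.
case: (ex_maxnP exP Pn) => m /asboolP[w [wZ wf]] mmax.
suff bw : basis_mod Z B w.
  by have [? ->] := dqE bw; split=> //; exact: bnd wf.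
split=> // x xZ; apply: contrapT => nspan.
pose w' (i : 'I_m.+1) := if unlift ord0 i is Some j then w j else x.
suff : P m.+1 by move/mmax; rewrite ltnn.
apply/asboolP; exists w'; split=> [i|c].
  by rewrite /w'; case: unliftP.
rewrite big_ord_recl {1}/w' unlift_none.
under eq_bigr do rewrite /w' liftK.
move=> cB.
have c0 : c ord0 = 0.
  apply: contrapT => /eqP cn0; apply: nspan.
  exists (fun i => - (c ord0)^-1 * c (lift ord0 i)).
  have := rpredZ (c ord0)^-1 cB.
  rewrite scalerDr scalerA mulVf // scale1r scaler_sumr -sumrN.
  rewrite [X in x + X \in _ -> _](_ : _ =
    \sum_i - (- (c ord0)^-1 * c (lift ord0 i) *: w i)) //.
  by apply: eq_bigr => i _; rewrite -scaleNr mulNr opprK scalerA.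
move: cB; rewrite c0 scale0r add0r => /wf cl i.
by case: (unliftP ord0 i) => [j ->|-> //]; exact: cl.
Qed.

(** The hypotheses exhibit [Z] modulo [B] as a subspace of a quotient of [Z'] modulo [B']. Free
    families therefore lift from the former to the latter. *)
Lemma dq_le V (Z B Z' B' : submodClosed V) :
  fin Z' B' ->
  (forall z, z \in Z -> exists2 z', z' \in Z' & z - z' \in B) ->
  (forall z, z \in Z' -> z \in B' -> z \in B) ->
  fin Z B /\ (dq Z B <= dq Z' B')%N.
Proof.
move=> fin' ZZ' BB'; apply: fin_bounded => m w wZ wf.
have exw i : exists z', z' \in Z' /\ w i - z' \in B.
  by have [z' ? ?] := ZZ' _ (wZ i); exists z'.
have [w' w'P] := choice exw.
apply: (free_mod_le fin' (w := w')) => [i|c cB]; first by case: (w'P i).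
apply: wf; have -> : \sum_i c i *: w i =
    \sum_i c i *: w' i + \sum_i c i *: (w i - w' i).
  by rewrite -big_split; apply: eq_bigr => i _ /=; rewrite -scalerDr subrKC.
rewrite rpredD //; last by apply: rpred_sum => i _; rewrite rpredZ //; case: (w'P i).
by apply: BB' => //; apply: rpred_sum => i _; rewrite rpredZ //; case: (w'P i).
Qed.

(** The three hypotheses say that [f] induces a well-defined isomorphism between the two
    subquotients, so bases are transported both ways. *)
Lemma dq_iso V W (f : {linear V -> W}) (Z B : submodClosed V)
    (Z' B' : submodClosed W) :
  (forall z, z \in Z -> exists2 z', z' \in Z' & f z - z' \in B') ->
  (forall z', z' \in Z' -> exists2 z, z \in Z & f z - z' \in B') ->
  (forall z, z \in Z -> (f z \in B') = (z \in B)) ->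
  (fin Z B <-> fin Z' B') /\ dq Z B = dq Z' B'.
Proof.
move=> ZZ' Z'Z BB'.
have to n (v : 'I_n -> V) : basis_mod Z B v ->
    exists v' : 'I_n -> W, basis_mod Z' B' v'.
  case=> vZ vf vs.
  have exw i : exists z', z' \in Z' /\ f (v i) - z' \in B'.
    by have [z' ? ?] := ZZ' _ (vZ i); exists z'.
  have [w wP] := choice exw.
  have sumE (c : 'I_n -> K) : f (\sum_i c i *: v i) - \sum_i c i *: w i \in B'.
    rewrite linear_sum -sumrB; apply: rpred_sum => i _.
    by rewrite linearZ -scalerBr rpredZ //; case: (wP i).
  exists w; split=> [i|c cB|z' /Z'Z[z zZ zz']]; first by case: (wP i).
    apply: vf; rewrite -BB'; last by apply: rpred_sum => i _; rewrite rpredZ.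
    by rewrite -[f _](subrK (\sum_i c i *: w i)) rpredD.
  have [c cP] := vs _ zZ; exists c.
  have -> : z' - \sum_i c i *: w i = - (f z - z') + f (z - \sum_i c i *: v i)
      + (f (\sum_i c i *: v i) - \sum_i c i *: w i).
    by rewrite (linearB f) /= (opprB (f z) z') !addrA !subrK.
  apply: rpredD (sumE c); apply: rpredD; first by rewrite memN.
  by rewrite BB' // memB //; apply: rpred_sum => i _; rewrite rpredZ.
have from n (w : 'I_n -> W) : basis_mod Z' B' w ->
    exists v : 'I_n -> V, basis_mod Z B v.
  case=> wZ wf ws.
  have exv i : exists z, z \in Z /\ f z - w i \in B'.
    by have [z ? ?] := Z'Z _ (wZ i); exists z.
  have [v vP] := choice exv.
  have vZ (c : 'I_n -> K) : \sum_i c i *: v i \in Z.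
    by apply: rpred_sum => i _; rewrite rpredZ //; case: (vP i).
  have sumE (c : 'I_n -> K) : f (\sum_i c i *: v i) - \sum_i c i *: w i \in B'.
    rewrite linear_sum -sumrB; apply: rpred_sum => i _.
    by rewrite linearZ -scalerBr rpredZ //; case: (vP i).
  exists v; split=> [i|c cB|z zZ]; first by case: (vP i).
    apply: wf; move: cB; rewrite -BB' // => cB.
    by rewrite -[X in X \in _](subKr (f (\sum_i c i *: v i))) memB.
  have [z' z'Z zz'] := ZZ' _ zZ.
  have [c cP] := ws _ z'Z; exists c.
  rewrite -BB' ?memB // linearB /=.
  have -> : f z - f (\sum_i c i *: v i) = (f z - z') + (z' - \sum_i c i *: w i)
      - (f (\sum_i c i *: v i) - \sum_i c i *: w i).
    by rewrite opprB !addrA !subrK.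
  by rewrite memB // rpredD.
have ff : fin Z B <-> fin Z' B'.
  by split=> [/finE[v /to]|/finE[v /from]] [w /dqE[]].
(* In the infinite-dimensional case both values of [dim] are the default 0, so the equality still
   holds. *)
split=> //; have [/finE[v /to[w /dqE[]]] //|nf] := pselect (fin Z B).
have nf' : ~ fin Z' B' by move/ff.
by rewrite /dq /Defs.dim !xgetPN // => n hn; [apply: nf'|apply: nf]; exists n.
Qed.

Lemma eq_dq V (Z B Z' B' : submodClosed V) :
  (forall z, z \in Z -> exists2 z', z' \in Z' & z - z' \in B') ->
  (forall z', z' \in Z' -> exists2 z, z \in Z & z - z' \in B') ->
  (forall z, z \in Z -> (z \in B') = (z \in B)) ->
  (fin Z B <-> fin Z' B') /\ dq Z B = dq Z' B'.
Proof. exact: (@dq_iso V V idfun). Qed.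

(** A basis of [M] modulo [B] followed by one of [Z] modulo [M] is a basis of [Z] modulo [B]. *)
Lemma fin_trans V (Z M B : submodClosed V) :
  {subset B <= M} -> {subset M <= Z} -> fin Z M -> fin M B ->
  fin Z B /\ dq Z B = (dq M B + dq Z M)%N.
Proof.
move=> BM MZ /finE[w [wZ wf ws]] /finE[v [vM vf vs]].
set m := dq M B in v vM vf vs *; set n := dq Z M in w wZ wf ws *.
pose u (i : 'I_(m + n)) := match fintype.split i with inl j => v j | inr j => w j end.
have uE (c : 'I_(m + n) -> K) : \sum_i c i *: u i =
    \sum_i c (lshift n i) *: v i + \sum_i c (rshift m i) *: w i.
  rewrite big_split_ord; congr (_ + _); apply: eq_bigr => i _; congr (_ *: _).
    by rewrite /u -[lshift _ _]/(unsplit (inl i)) unsplitK.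
  by rewrite /u -[rshift _ _]/(unsplit (inr i)) unsplitK.
have vsumM (c : 'I_m -> K) : \sum_i c i *: v i \in M.
  by apply: rpred_sum => i _; rewrite rpredZ.
apply: (@dqE _ _ _ _ u); split=> [i|c|x xZ].
- by rewrite /u; case: fintype.split => j //; exact: MZ.
- rewrite uE => cB.
  have cr : forall i, c (rshift m i) = 0.
    apply: wf; rewrite -[X in X \in _](addKr (\sum_i c (lshift n i) *: v i)).
    by rewrite rpredD ?memN // BM.
  move: cB; rewrite [X in _ + X]big1 => [|i _]; last by rewrite cr scale0r.
  rewrite addr0 => /vf cl i.
  by rewrite -(splitK i); case: (fintype.split i) => j; [exact: cl|exact: cr].
- have [c cM] := ws _ xZ; have [b bB] := vs _ cM.
  exists (fun i => match fintype.split i with inl j => b j | inr j => c j end).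
  rewrite uE; under eq_bigr do rewrite -[lshift _ _]/(unsplit (inl _)) unsplitK.
  under [X in _ - (_ + X)]eq_bigr do
    rewrite -[rshift _ _]/(unsplit (inr _)) unsplitK.
  by rewrite opprD addrA addrAC.
Qed.

Lemma fin_chain V (Z M B : submodClosed V) :
  {subset B <= M} -> {subset M <= Z} -> fin Z B ->
  [/\ fin Z M, fin M B & dq Z B = (dq M B + dq Z M)%N].
Proof.
move=> BM MZ fZ.
have [fZM _] : fin Z M /\ (dq Z M <= dq Z B)%N.
  by apply: dq_le => // z zZ; [exists z; rewrite ?subrr ?rpred0 | exact: BM].
have [fMB _] : fin M B /\ (dq M B <= dq Z B)%N.
  by apply: dq_le => // z zM; exists z; rewrite ?subrr ?rpred0 ?MZ.
by have [_ ?] := fin_trans BM MZ fZM fMB.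
Qed.

Lemma dq_eq0 V (Z B : submodClosed V) :
  fin Z B -> dq Z B = 0%N -> {subset Z <= B}.
Proof.
move=> /finE[v [_ _]]; move: v; case: (dq Z B) => // v vs _ x /vs[c].
by rewrite big_ord0 subr0.
Qed.

Lemma dq0 V (Z B : submodClosed V) :
  {subset Z <= B} -> fin Z B /\ dq Z B = 0%N.
Proof.
move=> ZB; apply: (@dqE _ _ _ _ (fun i : 'I_0 => 0)).
split=> [i|c _ []//|x /ZB xB]; first exact: rpred0.
by exists (fun=> 0); rewrite big_ord0 subr0.
Qed.

End Index.

(** * Additivity of dimension along a finite filtration *)

Section Filtration.
Variables (K : fieldType) (V : lmodType K).

(** Insert M = B + (Z :&: ker f) between [B] and [Z]. The map [f] identifies Z / M with f(Z) / f(B),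
    and M / B is (Z :&: ker f) / (B :&: ker f). *)
Lemma dq_ker (W : lmodType K) (f : {linear V -> W}) (Z B : submodClosed V) :
  {subset B <= Z} ->
  (fin Z B <-> fin (imS f Z) (imS f B)
     /\ fin (capS Z (kerS f)) (capS B (kerS f)))
  /\ (fin Z B -> dq Z B = (dq (imS f Z) (imS f B)
     + dq (capS Z (kerS f)) (capS B (kerS f)))%N).
Proof.
move=> BZ; pose M : submodClosed V := addS B (capS Z (kerS f)).
have BM : {subset B <= M}.
  by move=> b bB; apply/addSP; exists b, 0; rewrite addr0 rpred0.
have MZ : {subset M <= Z}.
  move=> x /addSP[b [z [bB]]].
  by rewrite mem_capS => /andP[zZ _] ->; rewrite rpredD // BZ.
have [f1 d1] : (fin Z M <-> fin (imS f Z) (imS f B))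
    /\ dq Z M = dq (imS f Z) (imS f B).
  apply: (dq_iso (f := f)) => [z zZ|_ /imSP[z zZ ->]|z zZ].
  - by exists (f z); rewrite ?subrr ?rpred0 //; apply/imSP; exists z.
  - by exists z; rewrite ?subrr ?rpred0.
  - apply/imSP/addSP => [[b bB fzb]|[b [y [bB]]]].
      exists b, (z - b); split; rewrite // ?subrKC // mem_capS mem_kerS.
      by rewrite linearB fzb subrr eqxx andbT memB // BZ.
    rewrite mem_capS mem_kerS => /andP[_ /eqP fy0] ->; exists b => //.
    by rewrite linearD fy0 addr0.
have [f2 d2] : (fin (capS Z (kerS f)) (capS B (kerS f)) <-> fin M B)
    /\ dq (capS Z (kerS f)) (capS B (kerS f)) = dq M B.
  apply: eq_dq => [z zZ|_ /addSP[b [z [bB zZ ->]]]|z].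
  - exists z; rewrite ?subrr ?rpred0 //; apply/addSP; exists 0, z.
    by rewrite add0r rpred0.
  - by exists z; rewrite // opprD addrCA subrr addr0 memN.
  - by rewrite !mem_capS => /andP[_ ->]; rewrite andbT.
split=> [|fZ].
  split=> [/(fin_chain BM MZ)[? ? _]|[/f1 fZM /f2 fMB]].
    by split; [exact/f1 | exact/f2].
  by case: (fin_trans BM MZ fZM fMB).
by have [_ _ ->] := fin_chain BM MZ fZ; rewrite -d1 -d2 addnC.
Qed.

Variable pi : nat -> {linear V -> V}.

(** The decreasing filtration by vanishing of the first [n] components. The image of step [n] under
    [pi n] is the space of leading components in degree [n]. *)
Fixpoint filt (Z : submodClosed V) n : submodClosed V :=
  if n is n'.+1 then capS (filt Z n') (kerS (pi n')) else Z.

Lemma filtP (Z : submodClosed V) n x :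
  reflect (x \in Z /\ forall j, (j < n)%N -> pi j x = 0) (x \in filt Z n).
Proof.
elim: n => [|n IH] /=; first by apply: (iffP idP) => [|[]].
rewrite mem_capS mem_kerS.
apply: (iffP andP) => [[/IH[xZ xn] /eqP xn0]|[xZ xn]].
  by split=> // j; rewrite ltnS leq_eqVlt => /predU1P[->|/xn].
rewrite xn //; split=> //; apply/IH; split=> // j jn; apply: xn; exact: ltnW.
Qed.

Lemma filt_sub (Z B : submodClosed V) n :
  {subset B <= Z} -> {subset filt B n <= filt Z n}.
Proof. by move=> BZ x /filtP[/BZ xZ x0]; apply/filtP. Qed.

Definition gr_dq (Z B : submodClosed V) i :=
  dq (imS (pi i) (filt Z i)) (imS (pi i) (filt B i)).
Definition gr_fin (Z B : submodClosed V) i :=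
  fin (imS (pi i) (filt Z i)) (imS (pi i) (filt B i)).

(** Each step of the filtration splits off one graded piece by [dq_ker]. After [n] steps nothing is
    left, because a vector of [Z] with no components is 0. *)
Lemma dq_gr (Z B : submodClosed V) n : {subset B <= Z} ->
  (forall x, x \in Z -> (forall i, (i < n)%N -> pi i x = 0) -> x = 0) ->
  (fin Z B <-> forall i, (i < n)%N -> gr_fin Z B i)
  /\ (fin Z B -> dq Z B = \sum_(i < n) gr_dq Z B i)%N.
Proof.
move=> BZ Z0.
suff [fP dP] : (fin Z B <-> (forall i, (i < n)%N -> gr_fin Z B i)
      /\ fin (filt Z n) (filt B n))
    /\ (fin Z B -> dq Z B =
        (\sum_(i < n) gr_dq Z B i + dq (filt Z n) (filt B n))%N).
  have [f0 d0] : fin (filt Z n) (filt B n) /\ dq (filt Z n) (filt B n) = 0%N.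
    by apply: dq0 => x /filtP[xZ /(Z0 _ xZ) ->]; exact: rpred0.
  split; last by move=> /dP ->; rewrite d0 addn0.
  by split=> [/fP[]|?]; last exact/fP.
elim: n {Z0} => [|n [fP dP]].
  by rewrite big_ord0; split=> //; split=> [|[]].
have [kP kE] := dq_ker (pi n) (filt_sub (n := n) BZ).
split=> [|fZ].
  rewrite fP kP; split=> [[fi [fn fS]]|[fi fS]].
    split=> // i; rewrite ltnS leq_eqVlt => /predU1P[-> //|]; exact: fi.
  split; first by move=> i /ltnW; exact: fi.
  by split=> //; exact: fi.
rewrite big_ord_recr /= dP // kE ?addnA //.
by case/fP: fZ.
Qed.

End Filtration.

(** * The modular-lattice count relating the two sides of the index identity *)

Section VarouchasCount.
Variables (K : fieldType) (V : lmodType K).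
Variables K1 K2 K12 I1 I2 I12 : submodClosed V.
Hypotheses (I12_1 : {subset I12 <= I1}) (I12_2 : {subset I12 <= I2}).
Hypotheses (I1K1 : {subset I1 <= K1}) (I2K2 : {subset I2 <= K2}).
Hypotheses (K1_12 : {subset K1 <= K12}) (K2_12 : {subset K2 <= K12}).

Lemma addS_subl (S T : submodClosed V) : {subset S <= addS S T}.
Proof. by move=> x xS; apply/addSP; exists x, 0; rewrite addr0 rpred0. Qed.

Lemma addS_subr (S T : submodClosed V) : {subset T <= addS S T}.
Proof. by move=> x xS; apply/addSP; exists 0, x; rewrite add0r rpred0. Qed.

Lemma addS_sub (S T U : submodClosed V) :
  {subset S <= U} -> {subset T <= U} -> {subset addS S T <= U}.
Proof. by move=> SU TU _ /addSP[y [z [/SU ? /TU ? ->]]]; rewrite rpredD. Qed.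

(** The second isomorphism theorem: [Z] modulo [B'] is Z + B' modulo [B']. *)
Lemma dq_addS (Z B' B : submodClosed V) :
  (forall x, x \in Z -> (x \in B') = (x \in B)) ->
  (fin Z B <-> fin (addS Z B') B') /\ dq Z B = dq (addS Z B') B'.
Proof.
move=> BB'; apply: eq_dq => // [z zZ|_ /addSP[z [b [zZ bB ->]]]].
  by exists z; rewrite ?subrr ?rpred0 ?addS_subl.
by exists z => //; rewrite opprD addNKr memN.
Qed.

(** With X = K1 :&: I2, refine the two quotients by the chains I12, I1 :&: I2, X, K1 :&: K2 and I1 +
    I2, K1 + I2, K1 + K2, K12. The outermost pieces are the two correction terms. Each inner piece
    of the first chain pairs with one of the second: X / (I1 :&: I2) and (K1 + I2) / (I1 + I2) make
    up K1 / I1, while (K1 :&: K2) / X and (K1 + K2) / (K1 + I2) make up K2 / I2. *)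
Lemma varouchas_count :
  fin (capS K1 K2) I12 -> fin K12 (addS I1 I2) ->
  [/\ fin K1 I1, fin K2 I2, fin (capS I1 I2) I12, fin K12 (addS K1 K2)
    & (dq (capS K1 K2) I12 + dq K12 (addS I1 I2) =
       dq K1 I1 + dq K2 I2 + dq (capS I1 I2) I12 + dq K12 (addS K1 K2))%N].
Proof.
move=> fBC fA.
pose X : submodClosed V := capS K1 I2.
have subX x : (x \in X) = (x \in K1) && (x \in I2) by [].
have [f1 f2 e1] : [/\ fin (capS K1 K2) X, fin X I12
    & dq (capS K1 K2) I12 = (dq X I12 + dq (capS K1 K2) X)%N].
  apply: fin_chain fBC => x.
    by move=> xI; rewrite subX I12_2 // I1K1 // I12_1.
  by rewrite subX mem_capS => /andP[-> /I2K2].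
have [f3 f4 e2] : [/\ fin X (capS I1 I2), fin (capS I1 I2) I12
    & dq X I12 = (dq (capS I1 I2) I12 + dq X (capS I1 I2))%N].
  apply: fin_chain f2 => x.
    by move=> xI; rewrite mem_capS I12_1 // I12_2.
  by rewrite subX mem_capS => /andP[/I1K1 -> ->].
have [f5 f6 e3] : [/\ fin K12 (addS K1 I2), fin (addS K1 I2) (addS I1 I2)
    & dq K12 (addS I1 I2) =
      (dq (addS K1 I2) (addS I1 I2) + dq K12 (addS K1 I2))%N].
  apply: fin_chain fA; last by apply: addS_sub => // x /I2K2/K2_12.
  by apply: addS_sub => x xI; [apply/addS_subl/I1K1|exact: addS_subr].
have [f7 f8 e4] : [/\ fin K12 (addS K1 K2), fin (addS K1 K2) (addS K1 I2)
    & dq K12 (addS K1 I2) =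
      (dq (addS K1 K2) (addS K1 I2) + dq K12 (addS K1 K2))%N].
  apply: fin_chain f5; last exact: addS_sub.
  by apply: addS_sub => x xI; [exact/addS_subl|exact/addS_subr/I2K2].
have [fX eX] : (fin X (capS I1 I2) <-> fin (addS X I1) I1)
    /\ dq X (capS I1 I2) = dq (addS X I1) I1.
  by apply: dq_addS => x; rewrite subX mem_capS => /andP[_ ->]; rewrite andbT.
have [fY eY] : (fin (capS K1 K2) X <-> fin (addS (capS K1 K2) I2) I2)
    /\ dq (capS K1 K2) X = dq (addS (capS K1 K2) I2) I2.
  by apply: dq_addS => x; rewrite subX mem_capS => /andP[-> _].
(* By modularity, K1 meets I1 + I2 in X + I1, because I1 lies in K1. *)
have [g1 h1] : (fin K1 (addS X I1) <-> fin (addS K1 I2) (addS I1 I2))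
    /\ dq K1 (addS X I1) = dq (addS K1 I2) (addS I1 I2).
  apply: eq_dq => [x xK|_ /addSP[y [z [yK zI ->]]]|x xK].
  - by exists x; rewrite ?subrr ?rpred0 ?addS_subl.
  - by exists y; rewrite // opprD addNKr memN addS_subr.
  - apply/addSP/addSP => [[y [z [yI zI xyz]]]|[y [z [yX zI xyz]]]].
      exists z, y; split=> //; last by rewrite addrC.
      rewrite subX zI andbT -[z](addKr y) -xyz rpredD // memN; exact: I1K1.
    exists z, y; split=> //; last by rewrite addrC.
    by case/andP: yX.
(* Likewise K2 meets K1 + I2 in (K1 :&: K2) + I2. *)
have [g2 h2] : (fin K2 (addS (capS K1 K2) I2) <->
      fin (addS K1 K2) (addS K1 I2))
    /\ dq K2 (addS (capS K1 K2) I2) = dq (addS K1 K2) (addS K1 I2).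
  apply: eq_dq => [x xK|_ /addSP[y [z [yK zI ->]]]|x xK].
  - by exists x; rewrite ?subrr ?rpred0 ?addS_subr.
  - by exists z => //; rewrite opprD addrCA subrr addr0 memN addS_subl.
  - apply/addSP/addSP => [[y [z [yI zI xyz]]]|[y [z [yX zI xyz]]]].
      exists y, z; split=> //.
      rewrite mem_capS yI -[y](addrK z) -xyz memB //; exact: I2K2.
    exists y, z; split=> //.
    by case/andP: yX.
have [k1 l1] : fin K1 I1 /\ dq K1 I1 = (dq (addS X I1) I1 + dq K1 (addS X I1))%N.
  apply: fin_trans; [exact: addS_subr| |exact/g1|exact/fX].
  by apply: addS_sub => // x /andP[].
have [k2 l2] : fin K2 I2 /\ dq K2 I2 = (dq (addS (capS K1 K2) I2) I2
    + dq K2 (addS (capS K1 K2) I2))%N.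
  apply: fin_trans; [exact: addS_subr| |exact/g2|exact/fY].
  by apply: addS_sub => // x /andP[].
by split=> //; lia.
Qed.

End VarouchasCount.

(** * The Froelicher inequality and its equality case, for a grading that [d1] shifts and [d2]
    preserves *)

Section Froelicher.
Variables (K : fieldType) (V : lmodType K).
Variables (d1 d2 : {linear V -> V}) (pi : nat -> {linear V -> V}) (n : nat).
Variables T T' : submodClosed V.
Hypothesis d1d1 : forall x, d1 (d1 x) = 0.
Hypothesis d2d2 : forall x, d2 (d2 x) = 0.
Hypothesis d1d2 : forall x, d1 (d2 x) + d2 (d1 x) = 0.
Hypothesis pi_d1S : forall i x, pi i.+1 (d1 x) = d1 (pi i x).
Hypothesis pi_d10 : forall x, pi 0%N (d1 x) = 0.
Hypothesis pi_d2 : forall i x, pi i (d2 x) = d2 (pi i x).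
Hypothesis pi_pi : forall i j x, pi i (pi j x) = if i == j then pi i x else 0.
Hypothesis piT : forall i x, x \in T -> pi i x \in T.
Hypothesis piT' : forall i x, x \in T' -> pi i x \in T'.
Hypothesis sum_pi : forall x, x \in T -> x = \sum_(i < n) pi i x.
Hypothesis d1T' : forall x, x \in T' -> d1 x \in T.
Hypothesis d2T' : forall x, x \in T' -> d2 x \in T.

(** In the application [T] and [T'] are the parts of total degree k and k - 1. Then Z / B is de Rham
    cohomology, and Z2 / B2 is the first page of the spectral sequence of the filtration by [pi]. *)
Let Z : submodClosed V := capS T (kerS (d1 \+ d2)).
Let B : submodClosed V := imS (d1 \+ d2) T'.
Let Z2 : submodClosed V := capS T (kerS d2).
Let B2 : submodClosed V := imS d2 T'.

Let BZ : {subset B <= Z}.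
Proof.
move=> _ /imSP[x xT ->]; rewrite mem_capS mem_kerS /= rpredD ?d1T' ?d2T' //=.
by rewrite !linearD d1d1 d2d2 addr0 add0r d1d2.
Qed.

Let BZ2 : {subset B2 <= Z2}.
Proof.
by move=> _ /imSP[x xT ->]; rewrite mem_capS mem_kerS /= d2d2 d2T' // eqxx.
Qed.

Let T_eq0 x : x \in T -> (forall i, (i < n)%N -> pi i x = 0) -> x = 0.
Proof. by move=> xT x0; rewrite (sum_pi xT) big1 // => i _; exact: x0. Qed.

(** Component [i] of d x = 0 is d1 of component i - 1 plus d2 of component [i]. The former vanishes
    when [i] is the leading degree. *)
Let gr_sub i : {subset imS (pi i) (filt pi Z i) <= imS (pi i) (filt pi Z2 i)}.
Proof.
move=> _ /imSP[x /filtP[xZ x0] ->].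
have d2x : d2 (pi i x) = 0.
  move: xZ; rewrite mem_capS mem_kerS => /andP[_ /eqP /(congr1 (pi i))].
  rewrite linear0 linearD pi_d2; case: i x0 => [|i] x0; rewrite ?pi_d10 ?add0r //.
  by rewrite pi_d1S x0 // linear0 add0r.
apply/imSP; exists (pi i x); last by rewrite pi_pi eqxx.
apply/filtP; split=> [|j ji]; last by rewrite pi_pi ltn_eqF.
by rewrite mem_capS mem_kerS d2x eqxx piT //; case/andP: xZ.
Qed.

(** The primitive [u] may be replaced by [pi i u]. Its total differential then has leading component
    d2 (pi i u), the d1 part lying one degree higher. *)
Let gr_bnd i : {subset imS (pi i) (filt pi B2 i) <= imS (pi i) (filt pi B i)}.
Proof.
move=> _ /imSP[_ /filtP[/imSP[u uT ->] _] ->].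
have pid1 j k : pi j (d1 (pi k u)) = if j == k.+1 then d1 (pi k u) else 0.
  case: j => [|j]; first by rewrite pi_d10.
  by rewrite pi_d1S pi_pi eqSS; case: eqP => [->|_] //; rewrite linear0.
apply/imSP; exists ((d1 \+ d2) (pi i u)).
  apply/filtP; split=> [|j ji]; first by apply/imSP; exists (pi i u); rewrite ?piT'.
  rewrite linearD pi_d2 pi_pi (ltn_eqF ji) linear0 addr0 pid1.
  by rewrite ltn_eqF // ltnW.
by rewrite linearD !pi_d2 pi_pi eqxx pid1 ltn_eqF // add0r.
Qed.

(* d-cycles and d-boundaries with leading component in degree i are compared with
   d2-cycles and d2-boundaries of degree i: the former have fewer cycles and more
   boundaries. *)
Lemma froelicher_ineq : fin Z2 B2 -> fin Z B /\ (dq Z B <= dq Z2 B2)%N.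
Proof.
have Z0 x : x \in Z -> (forall i, (i < n)%N -> pi i x = 0) -> x = 0.
  by move=> /andP[/T_eq0].
have Z20 x : x \in Z2 -> (forall i, (i < n)%N -> pi i x = 0) -> x = 0.
  by move=> /andP[/T_eq0].
have [fP dP] := dq_gr BZ Z0; have [fP2 dP2] := dq_gr BZ2 Z20.
move=> f2; have /fP2 gf2 := f2.
have le i : (i < n)%N -> gr_fin pi Z B i /\ (gr_dq pi Z B i <= gr_dq pi Z2 B2 i)%N.
  move=> /gf2 g; apply: dq_le => //.
    by move=> z /gr_sub zZ; exists z; rewrite ?subrr ?rpred0.
  by move=> z _ /gr_bnd.
have fZ : fin Z B by apply/fP => i /le[].
by split=> //; rewrite dP // dP2 //; apply: leq_sum => i _; case: (le i).
Qed.

(** Equality of dimensions forces equality in every graded piece, so each d2-cycle of degree i is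
    the leading component of a total cycle. The next component of that cycle shows that d1 of the
    given element is in the image of d2. *)
Lemma froelicher_eq : fin Z2 B2 -> dq Z B = dq Z2 B2 ->
  forall x, x \in T -> d2 x = 0 -> exists y, d1 x = d2 y.
Proof.
have Z0 x : x \in Z -> (forall i, (i < n)%N -> pi i x = 0) -> x = 0.
  by move=> /andP[/T_eq0].
have Z20 x : x \in Z2 -> (forall i, (i < n)%N -> pi i x = 0) -> x = 0.
  by move=> /andP[/T_eq0].
have [fP dP] := dq_gr BZ Z0; have [fP2 dP2] := dq_gr BZ2 Z20.
move=> f2; have /fP2 gf2 := f2; have [fZ _] := froelicher_ineq f2.
(* In each degree, the leading components form a chain: d2-boundaries, d-boundaries, d-cycles,
   d2-cycles. If the middle quotient is as large as the whole, the top quotient is zero. *)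
have chain i : (i < n)%N -> (gr_dq pi Z B i <= gr_dq pi Z2 B2 i)%N /\
    ((gr_dq pi Z2 B2 i <= gr_dq pi Z B i)%N ->
     {subset imS (pi i) (filt pi Z2 i) <= imS (pi i) (filt pi Z i)}).
  move=> /gf2 g.
  have BZi : {subset imS (pi i) (filt pi B i) <= imS (pi i) (filt pi Z i)}.
    by move=> _ /imSP[y /(filt_sub BZ) yZ ->]; apply/imSP; exists y.
  have B2Zi x : x \in imS (pi i) (filt pi B2 i) ->
    x \in imS (pi i) (filt pi Z i) by move=> /gr_bnd/BZi.
  have [g1 g2 e1] := fin_chain (Z := imS (pi i) (filt pi Z2 i))
    (M := imS (pi i) (filt pi Z i)) (B := imS (pi i) (filt pi B2 i))
    B2Zi (@gr_sub i) g.
  have [g3 g4 e2] := fin_chain (Z := imS (pi i) (filt pi Z i))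
    (M := imS (pi i) (filt pi B i)) (B := imS (pi i) (filt pi B2 i))
    (@gr_bnd i) BZi g2.
  rewrite /gr_dq; split=> [|le21]; first lia.
  by apply: (dq_eq0 g1); lia.
rewrite dP // dP2 // => sum_eq x xT d2x.
have sub i : (i < n)%N ->
    {subset imS (pi i) (filt pi Z2 i) <= imS (pi i) (filt pi Z i)}.
  move=> lt_in; case: (chain i lt_in) => _; apply.
  (* A sum of termwise inequalities is an equality only if every term is. *)
  have [_] := leqif_sum (fun (j : 'I_n) (_ : true) =>
    leqif_eq (chain j (ltn_ord j)).1).
  by rewrite sum_eq eqxx => /esym/forallP/(_ (Ordinal lt_in))/eqP ->.
have exy i : exists y, (i < n)%N -> d1 (pi i x) = d2 y.
  have [lt_in|] := boolP (i < n)%N; last by exists 0.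
  have /(sub i lt_in)/imSP[z] : pi i x \in imS (pi i) (filt pi Z2 i).
    apply/imSP; exists (pi i x); last by rewrite pi_pi eqxx.
    apply/filtP; split=> [|j ji]; last by rewrite pi_pi ltn_eqF.
    by rewrite mem_capS mem_kerS -pi_d2 d2x linear0 piT // eqxx.
  (* Component i + 1 of d z = 0 is d1 (pi i z) + d2 (pi i.+1 z) = 0, and [pi i z] equals
     [pi i x]. *)
  move=> /filtP[/andP[_ /eqP/(congr1 (pi i.+1))]].
  rewrite linear0 linearD pi_d1S pi_d2 => /eqP.
  by rewrite addr_eq0 => /eqP dz _ ->; exists (- pi i.+1 z); rewrite linearN.
have [y yP] := choice exy.
exists (\sum_(i < n) y i); rewrite [in LHS](sum_pi xT) !linear_sum.
by apply: eq_bigr => i _; exact: yP.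
Qed.
End Froelicher.

(** * Homogeneous components and projections of a bounded double complex *)

Section Components.
Variables (K : fieldType) (A : double_complex K).
Variables (D : seq (int * int)).
Hypothesis D_uniq : uniq D.
Hypothesis D_supp : forall pq (x : A),
  x \in part A pq.1 pq.2 -> pq \notin D -> x = 0.
Implicit Types (x y : A) (pq : int * int) (S : pred (int * int)) (k : int).

Let comp x := sval (cid (part_direct x)).

Let compP x : unique (fun f : int * int -> A =>
  [/\ forall pq, f pq \in part A pq.1 pq.2, finite_set [set pq | f pq != 0]%classic
    & x = \sum_(pq \in [set: int * int]%classic) f pq]) (comp x).
Proof. exact: (svalP (cid (part_direct x))). Qed.

Let supp_out (f : int * int -> A) :
  (forall pq, f pq \in part A pq.1 pq.2) -> forall pq, pq \notin D -> f pq = 0.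
Proof. by move=> fP pq; apply: D_supp. Qed.

Let fsum (f : int * int -> A) : (forall pq, f pq \in part A pq.1 pq.2) ->
  \sum_(pq \in [set: int * int]%classic) f pq = \sum_(pq <- D) f pq.
Proof.
move=> fP; rewrite (fsbigE D) //; last by move=> pq _; exact: supp_out.
by apply: eq_bigl => pq; rewrite in_setT.
Qed.

Let comp_in x pq : comp x pq \in part A pq.1 pq.2.
Proof. by case: (compP x) => -[]. Qed.

Let comp_sum x : x = \sum_(pq <- D) comp x pq.
Proof.
by case: (compP x) => -[_ _ xE] _; rewrite {1}xE; exact: (fsum (comp_in x)).
Qed.

Let comp_uniq x (f : int * int -> A) :
  (forall pq, f pq \in part A pq.1 pq.2) -> x = \sum_(pq <- D) f pq ->
  forall pq, comp x pq = f pq.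
Proof.
move=> fP xE pq; case: (compP x) => _ /(_ f) -> //; split=> //.
  apply: (@sub_finite_set _ _ [set` D]%classic); last by apply/finite_seqP; exists D.
  by move=> r /= r0; apply: contraNT r0 => /(supp_out fP)/eqP.
by rewrite fsum.
Qed.

(** Combining the components of [x] and [y] gives a decomposition of the combined vector, so
    uniqueness yields linearity. *)
Let comp_linear pq : linear (comp ^~ pq).
Proof.
move=> a x y; rewrite (@comp_uniq _ (fun r => a *: comp x r + comp y r)) //.
  by move=> r; rewrite rpredD ?rpredZ ?comp_in.
by rewrite big_split -scaler_sumr -!comp_sum.
Qed.

Let linear_of (f : A -> A) : linear f ->
  exists g : {linear A -> A}, forall x, g x = f x.
Proof.
move=> lf.
by exists (HB.pack_for {linear A -> A} f (GRing.isLinear.Build _ _ _ _ _ lf)).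
Qed.

Definition cmp pq : {linear A -> A} := sval (cid (linear_of (@comp_linear pq))).

Let cmpE pq x : cmp pq x = comp x pq.
Proof. exact: (svalP (cid (linear_of (@comp_linear pq)))). Qed.

Lemma cmp_in pq x : cmp pq x \in part A pq.1 pq.2.
Proof. by rewrite cmpE. Qed.

Lemma cmp_out pq x : pq \notin D -> cmp pq x = 0.
Proof. by apply: D_supp; exact: cmp_in. Qed.

Lemma cmp_sum x : x = \sum_(pq <- D) cmp pq x.
Proof. by rewrite {1}[x]comp_sum; apply: eq_bigr => pq _; rewrite cmpE. Qed.

Lemma cmp_uniq x (f : int * int -> A) :
  (forall pq, f pq \in part A pq.1 pq.2) -> x = \sum_(pq <- D) f pq ->
  forall pq, cmp pq x = f pq.
Proof. by move=> fP xE pq; rewrite cmpE; exact: comp_uniq. Qed.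

Lemma cmp_ext x y : (forall pq, cmp pq x = cmp pq y) -> x = y.
Proof.
by move=> xy; rewrite (cmp_sum x) (cmp_sum y); apply: eq_bigr => pq _.
Qed.

Lemma cmp_part p q x pq :
  x \in part A p q -> cmp pq x = if pq == (p, q) then x else 0.
Proof.
move=> xp; apply: (@cmp_uniq x (fun r => if r == (p, q) then x else 0)).
  by move=> r; case: eqP => [->|_] //; exact: rpred0.
rewrite -big_mkcond; have [pqD|pqD] := boolP ((p, q) \in D).
  by rewrite -big_filter filter_pred1_uniq // big_seq1.
by rewrite (@D_supp (p, q) x) // big1.
Qed.

Lemma cmp_d1 p q x : cmp (p, q) (del1 A x) = del1 A (cmp (p - 1, q) x).
Proof.
have xp r := del1_part (cmp_in r x).
rewrite {1}[x]cmp_sum !linear_sum /=.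
under eq_bigr do rewrite (cmp_part _ (xp _)).
rewrite -big_mkcond /=.
under eq_bigl => r.
  rewrite (_ : _ == _ = (r == (p - 1, q))); last first.
    by case: r => r1 r2; apply/eqP/eqP => -[-> ->]; rewrite ?addrK ?subrK.
  over.
(* Only the component at (p - 1, q) can reach (p, q); if that bidegree is outside [D], both sides
   are 0. *)
have [rD|rD] := boolP ((p - 1, q) \in D).
  by rewrite -big_filter filter_pred1_uniq // big_seq1.
rewrite (cmp_out _ rD) linear0 big_seq_cond big1 // => r /andP[rD' /eqP re].
by rewrite re (negPf rD) in rD'.
Qed.

Lemma cmp_d2 p q x : cmp (p, q) (del2 A x) = del2 A (cmp (p, q - 1) x).
Proof.
have xp r := del2_part (cmp_in r x).
rewrite {1}[x]cmp_sum !linear_sum /=.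
under eq_bigr do rewrite (cmp_part _ (xp _)).
rewrite -big_mkcond /=.
under eq_bigl => r.
  rewrite (_ : _ == _ = (r == (p, q - 1))); last first.
    by case: r => r1 r2; apply/eqP/eqP => -[-> ->]; rewrite ?addrK ?subrK.
  over.
have [rD|rD] := boolP ((p, q - 1) \in D).
  by rewrite -big_filter filter_pred1_uniq // big_seq1.
rewrite (cmp_out _ rD) linear0 big_seq_cond big1 // => r /andP[rD' /eqP re].
by rewrite re (negPf rD) in rD'.
Qed.

Let prj_fun S x := \sum_(pq <- D | S pq) cmp pq x.

Let prj_linear S : linear (prj_fun S).
Proof.
move=> a x y; rewrite /prj_fun scaler_sumr -big_split.
by apply: eq_bigr => pq _; rewrite linearP.
Qed.

Definition prj S : {linear A -> A} := sval (cid (linear_of (@prj_linear S))).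

Let prjE S x : prj S x = \sum_(pq <- D | S pq) cmp pq x.
Proof. exact: (svalP (cid (linear_of (@prj_linear S)))). Qed.

Lemma cmp_prj S pq x : cmp pq (prj S x) = if S pq then cmp pq x else 0.
Proof.
apply: (@cmp_uniq _ (fun r => if S r then cmp r x else 0)).
  by move=> r; case: ifP => _; rewrite ?cmp_in ?rpred0.
by rewrite prjE big_mkcond.
Qed.

Lemma mem_total k x :
  reflect (forall pq, pq.1 + pq.2 != k -> cmp pq x = 0) (x \in total A k).
Proof.
apply: (iffP (asboolP _)) => [[s sP ->] pq pqk|x0].
  rewrite linear_sum big1_seq // => y /sP[p [q [pqk' yp]]].
  rewrite (cmp_part _ yp); case: eqP => // pqe.
  by rewrite pqe /= pqk' eqxx in pqk.
exists [seq cmp pq x | pq <- D & pq.1 + pq.2 == k].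
  move=> y /mapP[pq]; rewrite mem_filter => /andP[/eqP pqk _] ->.
  by exists pq.1, pq.2; split=> //; exact: cmp_in.
rewrite big_map big_filter {1}[x]cmp_sum [RHS]big_mkcond.
by apply: eq_bigr => pq _; case: ifPn => // /x0.
Qed.

Lemma part_total p q k x : p + q = k -> x \in part A p q -> x \in total A k.
Proof.
move=> pqk xp; apply/mem_total => pq pqk'; rewrite (cmp_part _ xp).
by case: eqP => // pqe; rewrite pqe /= pqk eqxx in pqk'.
Qed.

Lemma prj_total S k x : x \in total A k -> prj S x \in total A k.
Proof.
by move=> /mem_total x0; apply/mem_total => pq /x0; rewrite cmp_prj => ->; case: ifP.
Qed.

Definition tot k := prj (fun pq => pq.1 + pq.2 == k).

Lemma tot_in k x : tot k x \in total A k.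
Proof. by apply/mem_total => pq /negPf pqk; rewrite cmp_prj pqk. Qed.

Lemma tot_id k x : x \in total A k -> tot k x = x.
Proof.
move=> /mem_total x0; apply: cmp_ext => pq; rewrite cmp_prj.
by case: ifPn => // /x0.
Qed.

Lemma tot_d1 k x : tot k (del1 A x) = del1 A (tot (k - 1) x).
Proof.
apply: cmp_ext => -[p q]; rewrite cmp_d1 !cmp_prj cmp_d1 /= addrAC.
by rewrite (inj_eq (addIr _)); case: ifP => _; rewrite ?linear0.
Qed.

Lemma tot_d2 k x : tot k (del2 A x) = del2 A (tot (k - 1) x).
Proof.
apply: cmp_ext => -[p q]; rewrite cmp_d2 !cmp_prj cmp_d2 /= addrA.
by rewrite (inj_eq (addIr _)); case: ifP => _; rewrite ?linear0.
Qed.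

Lemma d1_total k x : x \in total A (k - 1) -> del1 A x \in total A k.
Proof. by move=> /tot_id <-; rewrite -tot_d1 tot_in. Qed.

Lemma d2_total k x : x \in total A (k - 1) -> del2 A x \in total A k.
Proof. by move=> /tot_id <-; rewrite -tot_d2 tot_in. Qed.

(* The index i of pr1 and pr2 stands for the degree i - N. *)
Variable N : nat.
Hypothesis D_box : forall pq, pq \in D ->
  [/\ - N%:Z <= pq.1, pq.1 < N%:Z, - N%:Z <= pq.2 & pq.2 < N%:Z].

Definition pr1 (i : nat) := prj (fun pq => pq.1 == i%:Z - N%:Z).
Definition pr2 (i : nat) := prj (fun pq => pq.2 == i%:Z - N%:Z).

Lemma pr1_d1S i x : pr1 i.+1 (del1 A x) = del1 A (pr1 i x).
Proof.
apply: cmp_ext => -[p q]; rewrite cmp_d1 !cmp_prj cmp_d1 /=.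
have -> : (p == i.+1%:Z - N%:Z) = (p - 1 == i%:Z - N%:Z) by lia.
by case: ifP => _; rewrite ?linear0.
Qed.

Lemma pr2_d2S i x : pr2 i.+1 (del2 A x) = del2 A (pr2 i x).
Proof.
apply: cmp_ext => -[p q]; rewrite cmp_d2 !cmp_prj cmp_d2 /=.
have -> : (q == i.+1%:Z - N%:Z) = (q - 1 == i%:Z - N%:Z) by lia.
by case: ifP => _; rewrite ?linear0.
Qed.

Lemma pr1_d10 x : pr1 0 (del1 A x) = 0.
Proof.
apply: cmp_ext => -[p q]; rewrite cmp_prj cmp_d1 linear0 /=.
case: ifP => // /eqP pN; rewrite cmp_out ?linear0 //.
by apply/negP => /D_box[] /=; lia.
Qed.

Lemma pr2_d20 x : pr2 0 (del2 A x) = 0.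
Proof.
apply: cmp_ext => -[p q]; rewrite cmp_prj cmp_d2 linear0 /=.
case: ifP => // /eqP pN; rewrite cmp_out ?linear0 //.
by apply/negP => /D_box[] /=; lia.
Qed.

Lemma pr1_d2 i x : pr1 i (del2 A x) = del2 A (pr1 i x).
Proof.
apply: cmp_ext => -[p q]; rewrite cmp_d2 !cmp_prj cmp_d2 /=.
by case: ifP => _; rewrite ?linear0.
Qed.

Lemma pr2_d1 i x : pr2 i (del1 A x) = del1 A (pr2 i x).
Proof.
apply: cmp_ext => -[p q]; rewrite cmp_d1 !cmp_prj cmp_d1 /=.
by case: ifP => _; rewrite ?linear0.
Qed.

Lemma pr1_pr1 i j x : pr1 i (pr1 j x) = if i == j then pr1 i x else 0.
Proof.
apply: cmp_ext => pq; rewrite !cmp_prj (fun_if (cmp pq)) cmp_prj linear0.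
by case: eqP => [->|ij]; do 2?case: eqP => //; lia.
Qed.

Lemma pr2_pr2 i j x : pr2 i (pr2 j x) = if i == j then pr2 i x else 0.
Proof.
apply: cmp_ext => pq; rewrite !cmp_prj (fun_if (cmp pq)) cmp_prj linear0.
by case: eqP => [->|ij]; do 2?case: eqP => //; lia.
Qed.

(** The box confines F to the interval from -N to N - 1, so the 2N shifted indices cover it. At each
    bidegree of [D] only the index F + N contributes. *)
Let sum_prj (F : int * int -> int) :
  (forall pq, pq \in D -> - N%:Z <= F pq /\ F pq < N%:Z) ->
  forall x, x = \sum_(i < (2 * N)%N) prj (fun pq => F pq == i%:Z - N%:Z) x.
Proof.
move=> Fbox x; apply: cmp_ext => pq; rewrite linear_sum /=.
under eq_bigr do rewrite cmp_prj.
have [/Fbox[F1 F2]|pqD] := boolP (pq \in D); last first.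
  by rewrite cmp_out // big1 // => i _; case: ifP.
have lt_i : (absz (F pq + N%:Z)%R < 2 * N)%N by lia.
rewrite (bigD1 (Ordinal lt_i)) //= ifT; last lia.
rewrite big1 ?addr0 // => i /eqP ine; case: eqP => // Fi.
by case: ine; apply: val_inj => /=; lia.
Qed.

Lemma sum_pr1 x : x = \sum_(i < (2 * N)%N) pr1 i x.
Proof. by apply: (@sum_prj fst) => pq /D_box[]. Qed.

Lemma sum_pr2 x : x = \sum_(i < (2 * N)%N) pr2 i x.
Proof. by apply: (@sum_prj snd) => pq /D_box[]. Qed.

(** Once the total degree is fixed, the first degree determines the second. *)
Lemma pr1_part i k x :
  x \in total A k -> pr1 i x \in part A (i%:Z - N%:Z) (k - (i%:Z - N%:Z)).
Proof.
move=> /mem_total x0; set p := i%:Z - N%:Z.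
have -> : pr1 i x = cmp (p, k - p) x.
  apply: cmp_ext => -[r s]; rewrite cmp_prj (cmp_part _ (cmp_in _ x)) /=.
  rewrite -/p xpair_eqE; case: eqP => //= ->; case: eqP => [->|sk] //.
  by apply: x0 => /=; apply/eqP => rs; apply: sk; lia.
exact: cmp_in.
Qed.

Lemma pr1_id i q x : x \in part A (i%:Z - N%:Z) q -> forall j,
  pr1 j x = if j == i then x else 0.
Proof.
move=> xp j; apply: cmp_ext => -[r s].
rewrite cmp_prj (fun_if (cmp (r, s))) linear0 (cmp_part _ xp) /= xpair_eqE.
case: (j =P i) => [->|ji]; first by case: eqP.
by case: eqP => // -> /=; case: eqP => //= e; lia.
Qed.

(** The filtration by first degree splits [Z] and [B] into homogeneous pieces, because both are
    stable under the projections. Replacing [B] by B :&: Z leaves the quotient unchanged and gives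
    the inclusion that [dq_gr] requires. *)
Lemma graded_dq (k : int) (Z B : submodClosed A) (Zp : int -> submodClosed A) :
  {subset Z <= total A k} ->
  (forall p x, (x \in Zp p) = (x \in Z) && (x \in part A p (k - p))) ->
  (forall i x, x \in Z -> pr1 i x \in Z) ->
  (forall i x, x \in B -> pr1 i x \in B) ->
  (forall p, fin (Zp p) B) ->
  fin Z B /\ (dq Z B = \sum_(i < (2 * N)%N) dq (Zp (i%:Z - N%:Z)%R) B)%N.
Proof.
move=> Zk ZpE prZ prB fZp.
pose B' : submodClosed A := capS B Z.
have B'Z : {subset B' <= Z} by move=> x /andP[].
have [fB' ->] : (fin Z B <-> fin Z B') /\ dq Z B = dq Z B'.
  apply: eq_dq => [x xZ|x xZ|x xZ]; first by exists x; rewrite ?subrr ?rpred0.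
    by exists x; rewrite ?subrr ?rpred0.
  by rewrite mem_capS xZ andbT.
have Z0 x : x \in Z -> (forall i, (i < 2 * N)%N -> pr1 i x = 0) -> x = 0.
  by move=> _ x0; rewrite [x]sum_pr1 big1 // => i _; exact: x0.
have [fP dP] := dq_gr B'Z Z0.
have gr i : (gr_fin pr1 Z B' i <-> fin (Zp (i%:Z - N%:Z)) B)
    /\ gr_dq pr1 Z B' i = dq (Zp (i%:Z - N%:Z)) B.
  have imE (Y : submodClosed A) y : y \in Zp (i%:Z - N%:Z) -> y \in Y ->
      y \in imS (pr1 i) (filt pr1 Y i).
    rewrite ZpE => /andP[_ /pr1_id yp] yY.
    apply/imSP; exists y; last by rewrite yp eqxx.
    by apply/filtP; split=> // j ji; rewrite yp ltn_eqF.
  have imZ z : z \in imS (pr1 i) (filt pr1 Z i) -> z \in Zp (i%:Z - N%:Z).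
    by move=> /imSP[y /filtP[yZ _] ->]; rewrite ZpE prZ //= pr1_part // Zk.
  apply: eq_dq => [z zi|z zZ|z zi].
  - by exists z; rewrite ?imZ ?subrr ?rpred0.
  - exists z; rewrite ?subrr ?rpred0 ?imE //.
    by move: zZ; rewrite ZpE => /andP[].
  - apply/idP/imSP => [zB|[y /filtP[/andP[yB _] _] ->]]; last exact: prB.
    have zZp := imZ _ zi.
    have : z \in imS (pr1 i) (filt pr1 B' i).
      by apply: imE => //; rewrite mem_capS zB; move: zZp; rewrite ZpE => /andP[].
    by case/imSP => y; exists y.
have fZ : fin Z B' by apply/fP => i _; apply/(gr i).1.
split; first exact/fB'.
by rewrite dP //; apply: eq_bigr => i _; case: (gr i).
Qed.

(** The 2N listed points include every point of [D] on the antidiagonal; any others contribute 0. *)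
Lemma fsum_antidiag (k : int) (F : int * int -> int) :
  (forall pq, pq \notin D -> F pq = 0) ->
  \sum_(pq \in [set pq : int * int | pq.1 + pq.2 = k]%classic) F pq =
  \sum_(i < (2 * N)%N) F (i%:Z - N%:Z, k - (i%:Z - N%:Z)).
Proof.
move=> F0.
have rk pq : pq \in [seq (i%:Z - N%:Z, k - (i%:Z - N%:Z)) | i <- iota 0 (2 * N)]
    -> pq.1 + pq.2 = k by move=> /mapP[i _ ->] /=; rewrite subrKC.
rewrite (fsbigE [seq (i%:Z - N%:Z, k - (i%:Z - N%:Z)) | i <- iota 0 (2 * N)]).
- rewrite big_seq_cond (eq_bigl (fun pq => pq \in
    [seq (i%:Z - N%:Z, k - (i%:Z - N%:Z)) | i <- iota 0 (2 * N)])) => [|pq].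
    by rewrite -big_seq big_map -[X in iota 0 X]subn0 big_mkord.
  by apply: andb_idr => /rk pqk; rewrite inE.
- rewrite map_inj_uniq ?iota_uniq // => i j [] ij _; lia.
- by move=> pq /= /rk.
- move=> [p q] /= pqk pqn; apply: F0; apply: contra pqn => /D_box[/= ? ? _ _].
  apply/mapP; exists (absz (p + N%:Z)); first by rewrite mem_iota; lia.
  by congr pair; lia.
Qed.


(** * Kernels, images and dimension counts in a fixed total degree *)

Local Notation d1 := (del1 A).
Local Notation d2 := (del2 A).

Definition K1 k : submodClosed A := capS (total A k) (kerS d1).
Definition K2 k : submodClosed A := capS (total A k) (kerS d2).
Definition K12 k : submodClosed A := capS (total A k) (kerS (d1 \o d2)).
Definition I1 k : submodClosed A := capS (total A k) (imS d1 (fullS A)).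
Definition I2 k : submodClosed A := capS (total A k) (imS d2 (fullS A)).
Definition I12 k : submodClosed A := capS (total A k) (BC_boundaries A).

Lemma d2d1 x : d2 (d1 x) = - d1 (d2 x).
Proof. by apply/eqP; rewrite -addr_eq0 addrC del1_del2. Qed.

Lemma K1P k x : reflect (x \in total A k /\ d1 x = 0) (x \in K1 k).
Proof. by apply: (iffP andP) => -[? /eqP]. Qed.

Lemma K2P k x : reflect (x \in total A k /\ d2 x = 0) (x \in K2 k).
Proof. by apply: (iffP andP) => -[? /eqP]. Qed.

Lemma K12P k x : reflect (x \in total A k /\ d1 (d2 x) = 0) (x \in K12 k).
Proof. by apply: (iffP andP) => -[? /eqP]. Qed.

Lemma mem_im1 x : d1 x \in imS d1 (fullS A).
Proof. by apply/imSP; exists x. Qed.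

Lemma mem_im2 x : d2 x \in imS d2 (fullS A).
Proof. by apply/imSP; exists x. Qed.

Lemma mem_A1 x : d1 x \in A_boundaries A.
Proof. exact/addS_subl/mem_im1. Qed.

Lemma mem_A2 x : d2 x \in A_boundaries A.
Proof. exact/addS_subr/mem_im2. Qed.

Lemma mem_im12 x : d1 (d2 x) \in BC_boundaries A.
Proof. by apply/imSP; exists x. Qed.

(** Primitives of arbitrary degree can be projected to degree k - 1, since projection to a total
    degree commutes with both differentials up to the shift. *)
Lemma A_boundariesP k x : x \in total A k -> x \in A_boundaries A ->
  exists y z, [/\ y \in total A (k - 1), z \in total A (k - 1)
    & x = d1 y + d2 z].
Proof.
move=> xk /addSP[_ [_ [/imSP[y _ ->] /imSP[z _ ->] xE]]].
exists (tot (k - 1) y), (tot (k - 1) z).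
by rewrite -{1}(tot_id xk) xE !tot_in linearD tot_d1 tot_d2.
Qed.

(** The second clause keeps track of an argument in im d2, so that projection also preserves im d1
    d2. The index 0 is separate because nothing lies below the box. *)
Lemma pr1_d1_eq i x : exists y, pr1 i (d1 x) = d1 y /\
  (forall z, x = d2 z -> exists w, y = d2 w).
Proof.
case: i => [|i].
  exists 0; rewrite pr1_d10 linear0; split=> // z _.
  by exists 0; rewrite linear0.
exists (pr1 i x); rewrite pr1_d1S; split=> // z ->.
by exists (pr1 i z); rewrite pr1_d2.
Qed.

Lemma BC_count k : (forall p q, fin_dim (H_BC A p q)) ->
  fin (capS (K1 k) (K2 k)) (I12 k) /\ dq (capS (K1 k) (K2 k)) (I12 k) =
  (\sum_(i < (2 * N)%N)
    Defs.dim (H_BC A (i%:Z - N%:Z)%R (k - (i%:Z - N%:Z))%R))%N.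
Proof.
move=> finBC.
have [] := @graded_dq k (capS (K1 k) (K2 k)) (BC_boundaries A)
  (fun p => BC_cycles A p (k - p)).
- by move=> x /andP[/K1P[]].
- move=> p x; apply/idP/idP => [/andP[xp /andP[/eqP d1x /eqP d2x]]|].
    rewrite mem_capS xp andbT; apply/andP; split; [apply/K1P|apply/K2P];
      by split=> //; apply: part_total xp; rewrite subrKC.
  rewrite mem_capS => /andP[/andP[/K1P[_ d1x] /K2P[_ d2x]] xp].
  by rewrite !mem_capS !mem_kerS xp d1x d2x eqxx.
- move=> i x /andP[/K1P[xk d1x] /K2P[_ d2x]]; rewrite mem_capS.
  apply/andP; split; [apply/K1P|apply/K2P]; split; rewrite ?prj_total //.
    by rewrite -pr1_d1S d1x linear0.
  by rewrite -pr1_d2 d2x linear0.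
- move=> i _ /imSP[x _ ->] /=; have [y [-> /(_ x erefl)[w ->]]] := pr1_d1_eq i (d2 x).
  exact: mem_im12.
- by move=> p; exact: finBC.
move=> fBC dBC.
have [f d] : (fin (capS (K1 k) (K2 k)) (I12 k) <->
    fin (capS (K1 k) (K2 k)) (BC_boundaries A))
    /\ dq (capS (K1 k) (K2 k)) (I12 k) = dq (capS (K1 k) (K2 k)) (BC_boundaries A).
  apply: eq_dq => [x xZ|x xZ|x /andP[/K1P[xk _] _]].
  - by exists x; rewrite ?subrr ?rpred0.
  - by exists x; rewrite ?subrr ?rpred0.
  - by rewrite mem_capS xk.
split; first exact/f.
by rewrite d dBC.
Qed.

Lemma A_count k : (forall p q, fin_dim (H_A A p q)) ->
  fin (K12 k) (addS (I1 k) (I2 k)) /\ dq (K12 k) (addS (I1 k) (I2 k)) =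
  (\sum_(i < (2 * N)%N)
    Defs.dim (H_A A (i%:Z - N%:Z)%R (k - (i%:Z - N%:Z))%R))%N.
Proof.
move=> finA.
have [] := @graded_dq k (K12 k) (A_boundaries A) (fun p => A_cycles A p (k - p)).
- by move=> x /K12P[].
- move=> p x; apply/idP/idP => [/andP[xp /eqP d12x]|].
    rewrite xp andbT; apply/K12P.
    by split=> //; apply: part_total xp; rewrite subrKC.
  by move=> /andP[/K12P[_ d12x] xp]; rewrite !mem_capS !mem_kerS xp /= d12x eqxx.
- move=> i x /K12P[xk d12x]; apply/K12P; split; rewrite ?prj_total //.
  by rewrite -pr1_d2 -pr1_d1S d12x linear0.
- move=> i _ /addSP[_ [_ [/imSP[y _ ->] /imSP[z _ ->] ->]]].
  rewrite linearD pr1_d2; have [w [-> _]] := pr1_d1_eq i y.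
  by rewrite rpredD ?mem_A1 ?mem_A2.
- by move=> p; exact: finA.
move=> fA dA.
have [f d] : (fin (K12 k) (addS (I1 k) (I2 k)) <->
    fin (K12 k) (A_boundaries A))
    /\ dq (K12 k) (addS (I1 k) (I2 k)) = dq (K12 k) (A_boundaries A).
  apply: eq_dq => [x xZ|x xZ|x /K12P[xk _]].
  - by exists x; rewrite ?subrr ?rpred0.
  - by exists x; rewrite ?subrr ?rpred0.
  - apply/idP/idP => [/(A_boundariesP xk)[y [z [yk zk ->]]]|].
      apply: rpredD; [apply: addS_subl|apply: addS_subr].
        by rewrite mem_capS mem_im1 d1_total.
      by rewrite mem_capS mem_im2 d2_total.
    move=> /addSP[y [z [/andP[_ yI] /andP[_ zI] ->]]].
    by apply: rpredD; [exact: addS_subl|exact: addS_subr].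
split; first exact/f.
by rewrite d dA.
Qed.

(** Cohomology vanishes at bidegrees outside [D], which turns the sum over the antidiagonal into a
    sum of 2N terms. *)
Lemma Delta_count k : (forall p q, fin_dim (H_BC A p q)) ->
  (forall p q, fin_dim (H_A A p q)) ->
  Delta A k = (dq (capS (K1 k) (K2 k)) (I12 k)
    + dq (K12 k) (addS (I1 k) (I2 k)))%N%:Z - 2 * (Defs.dim (H_dR A k))%:Z.
Proof.
move=> /(@BC_count k)[_ ->] /(@A_count k)[_ ->]; rewrite /Delta; congr (_ - _).
rewrite (@fsum_antidiag k (fun pq => _ + _)) => [|pq pqD].
  by rewrite -big_split (big_morph Posz PoszD (erefl _)).
have [_ BC0] : fin (BC_cycles A pq.1 pq.2) (BC_boundaries A)
    /\ dq (BC_cycles A pq.1 pq.2) (BC_boundaries A) = 0%N.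
  by apply: dq0 => x /andP[/D_supp/(_ pqD) -> _]; exact: rpred0.
have [_ A0] : fin (A_cycles A pq.1 pq.2) (A_boundaries A)
    /\ dq (A_cycles A pq.1 pq.2) (A_boundaries A) = 0%N.
  by apply: dq0 => x /andP[/D_supp/(_ pqD) -> _]; exact: rpred0.
by rewrite -[Defs.dim (H_BC _ _ _)]/(dq _ _) -[Defs.dim (H_A _ _ _)]/(dq _ _) BC0 A0.
Qed.

(** The abstract argument is applied with the two differentials exchanged and the filtration taken
    by second degree. *)
Lemma K1_froelicher k : fin (K1 k) (I1 k) ->
  [/\ fin_dim (H_dR A k), (Defs.dim (H_dR A k) <= dq (K1 k) (I1 k))%N
    & Defs.dim (H_dR A k) = dq (K1 k) (I1 k) ->
      forall x, x \in total A k -> d1 x = 0 -> exists y, d2 x = d1 y].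
Proof.
have [f1 e1] : (fin (K1 k) (I1 k) <-> fin (K1 k) (imS d1 (total A (k - 1))))
    /\ dq (K1 k) (I1 k) = dq (K1 k) (imS d1 (total A (k - 1))).
  apply: eq_dq => [x xZ|x xZ|x /K1P[xk _]].
  - by exists x; rewrite ?subrr ?rpred0.
  - by exists x; rewrite ?subrr ?rpred0.
  - apply/imSP/andP => [[y yk ->]|[_ /imSP[y _ xy]]].
      by rewrite mem_im1 d1_total.
    by exists (tot (k - 1) y); rewrite ?tot_in // -tot_d1 -xy tot_id.
(* The exchange writes the total differential as d2 + d1, which has to be matched with d1 + d2. *)
have [f0 e0] : (fin (capS (total A k) (kerS (d2 \+ d1)))
        (imS (d2 \+ d1) (total A (k - 1))) <-> fin_dim (H_dR A k))
    /\ dq (capS (total A k) (kerS (d2 \+ d1)))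
        (imS (d2 \+ d1) (total A (k - 1))) = Defs.dim (H_dR A k).
  apply: (@eq_dq _ _ _ _ (dR_cycles A k) (dR_boundaries A k)).
  - move=> x; rewrite mem_capS mem_kerS /= addrC => xZ.
    by exists x; rewrite ?subrr ?rpred0.
  - move=> x; rewrite mem_capS mem_kerS /= addrC => xZ.
    by exists x; rewrite ?subrr ?rpred0.
  - by move=> x _; apply/imSP/imSP => -[y yk ->]; exists y; rewrite //= addrC.
have d21 x : d2 (d1 x) + d1 (d2 x) = 0 by rewrite addrC del1_del2.
have frI := froelicher_ineq (@del2_del2 _ A) (@del1_del1 _ A) d21 pr2_d2S pr2_d20
  pr2_d1 pr2_pr2 (fun i x => @prj_total _ k x) (fun i x => @prj_total _ (k - 1) x)
  (fun x _ => sum_pr2 x) (@d2_total k) (@d1_total k).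
have frE := froelicher_eq (@del2_del2 _ A) (@del1_del1 _ A) d21 pr2_d2S pr2_d20
  pr2_d1 pr2_pr2 (fun i x => @prj_total _ k x) (fun i x => @prj_total _ (k - 1) x)
  (fun x _ => sum_pr2 x) (@d2_total k) (@d1_total k).
move=> /f1 fK; have [/f0 fdR le] := frI fK.
split=> //; first by rewrite -e0 e1.
by rewrite -e0 e1; exact: frE.
Qed.

Lemma K2_froelicher k : fin (K2 k) (I2 k) ->
  (Defs.dim (H_dR A k) <= dq (K2 k) (I2 k))%N /\
  (Defs.dim (H_dR A k) = dq (K2 k) (I2 k) ->
    forall x, x \in total A k -> d2 x = 0 -> exists y, d1 x = d2 y).
Proof.
have [f2 e2] : (fin (K2 k) (I2 k) <-> fin (K2 k) (imS d2 (total A (k - 1))))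
    /\ dq (K2 k) (I2 k) = dq (K2 k) (imS d2 (total A (k - 1))).
  apply: eq_dq => [x xZ|x xZ|x /K2P[xk _]].
  - by exists x; rewrite ?subrr ?rpred0.
  - by exists x; rewrite ?subrr ?rpred0.
  - apply/imSP/andP => [[y yk ->]|[_ /imSP[y _ xy]]].
      by rewrite mem_im2 d2_total.
    by exists (tot (k - 1) y); rewrite ?tot_in // -tot_d2 -xy tot_id.
have frI := froelicher_ineq (@del1_del1 _ A) (@del2_del2 _ A) (@del1_del2 _ A)
  pr1_d1S pr1_d10
  pr1_d2 pr1_pr1 (fun i x => @prj_total _ k x) (fun i x => @prj_total _ (k - 1) x)
  (fun x _ => sum_pr1 x) (@d1_total k) (@d2_total k).
have frE := froelicher_eq (@del1_del1 _ A) (@del2_del2 _ A) (@del1_del2 _ A)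
  pr1_d1S pr1_d10
  pr1_d2 pr1_pr1 (fun i x => @prj_total _ k x) (fun i x => @prj_total _ (k - 1) x)
  (fun x _ => sum_pr1 x) (@d1_total k) (@d2_total k).
move=> /f2 fK; have [_ le] := frI fK; rewrite e2; split=> //; exact: frE.
Qed.

Hypothesis finBC : forall p q, fin_dim (H_BC A p q).
Hypothesis finA : forall p q, fin_dim (H_A A p q).

Lemma varouchas_count_total k :
  [/\ fin (K1 k) (I1 k), fin (K2 k) (I2 k), fin (capS (I1 k) (I2 k)) (I12 k),
    fin (K12 k) (addS (K1 k) (K2 k))
    & Delta A k = (dq (K1 k) (I1 k) + dq (K2 k) (I2 k)
        + dq (capS (I1 k) (I2 k)) (I12 k) + dq (K12 k) (addS (K1 k) (K2 k)))%N%:Z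
        - 2 * (Defs.dim (H_dR A k))%:Z].
Proof.
have [fBC _] := BC_count k finBC; have [fA _] := A_count k finA.
rewrite Delta_count //.
have [||||||f1 f2 fa ff ->] := varouchas_count _ _ _ _ _ _ fBC fA; last by split.
- by move=> x /andP[xk /imSP[y _ xy]]; rewrite mem_capS xk xy mem_im1.
- move=> x /andP[xk /imSP[y _ xy]]; rewrite mem_capS xk.
  by rewrite xy /= -[d1 _]opprK -d2d1 memN mem_im2.
- by move=> x /andP[xk /imSP[y _ xy]]; apply/K1P; rewrite xy del1_del1 -xy.
- by move=> x /andP[xk /imSP[y _ xy]]; apply/K2P; rewrite xy del2_del2 -xy.
- by move=> x /K1P[xk d1x]; apply/K12P; rewrite -[d1 _]opprK -d2d1 d1x linear0 oppr0.
- by move=> x /K2P[xk d2x]; apply/K12P; rewrite d2x linear0.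
Qed.

Lemma Delta_ge0 k : 0 <= Delta A k.
Proof.
have [f1 f2 _ _ ->] := varouchas_count_total k.
have [_ le1 _] := K1_froelicher f1; have [le2 _] := K2_froelicher f2.
lia.
Qed.

(** Delta is the sum of four nonnegative terms: the two Froelicher defects and the two indices. Each
    of them must vanish. *)
Lemma Delta_eq0 k : Delta A k = 0 ->
  [/\ forall x, x \in total A k -> d1 x = 0 -> exists y, d2 x = d1 y,
      forall x, x \in total A k -> d2 x = 0 -> exists y, d1 x = d2 y,
      {subset capS (I1 k) (I2 k) <= I12 k}
    & {subset K12 k <= addS (K1 k) (K2 k)}].
Proof.
have [f1 f2 fa ff ->] := varouchas_count_total k.
have [_ le1 eq1] := K1_froelicher f1; have [le2 eq2] := K2_froelicher f2.
move=> D0; split.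
- by apply: eq1; lia.
- by apply: eq2; lia.
- by apply: (dq_eq0 fa); lia.
- by apply: (dq_eq0 ff); lia.
Qed.

(** * The lemma on elements, and its equivalence with the vanishing of Delta *)

Definition ddlemma_total := forall x, d1 x = 0 -> d2 x = 0 ->
  x \in A_boundaries A -> x \in BC_boundaries A.

Lemma ddlemmaE : ddlemma A <->
  (forall p q x, x \in part A p q -> d1 x = 0 -> d2 x = 0 ->
    x \in A_boundaries A -> x \in BC_boundaries A).
Proof.
split=> [dd p q x xp d1x d2x xA|dd p q u v].
  have xZ : x \in BC_cycles A p q by rewrite !mem_capS !mem_kerS xp d1x d2x eqxx.
  have /dd : BC_to_A (cls (BC_boundaries A) (Subsp xZ)) =
      BC_to_A (cls (BC_boundaries A) (0 : subsp (BC_cycles A p q))).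
    by rewrite !BC_to_A_cls; apply/clsE; rewrite /= subr0.
  by move/clsE; rewrite /= subr0.
rewrite -(cls_repr u) -(cls_repr v) !BC_to_A_cls => /clsE uv; apply/clsE.
move: uv; rewrite /=.
have /andP[up /andP[/eqP d1u /eqP d2u]] := valP (repr u).
have /andP[vp /andP[/eqP d1v /eqP d2v]] := valP (repr v).
apply: (dd p q); first exact: memB up vp.
- by rewrite linearB [X in X - _]d1u [X in _ - X]d1v subrr.
- by rewrite linearB [X in X - _]d2u [X in _ - X]d2v subrr.
Qed.

(** Components of a vector inherit the three hypotheses, because the differentials are
    homogeneous. *)
Lemma ddlemma_totalP : ddlemma A -> ddlemma_total.
Proof.
move=> /ddlemmaE dd x d1x d2x /addSP[_ [_ [/imSP[y _ ->] /imSP[z _ ->] xE]]].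
rewrite [x]cmp_sum; apply: rpred_sum => -[p q] _.
apply: (dd p q); first exact: (cmp_in (p, q)).
- by rewrite -(addrK 1 p) -cmp_d1 d1x linear0.
- by rewrite -(addrK 1 q) -cmp_d2 d2x linear0.
- by rewrite xE linearD cmp_d1 cmp_d2 rpredD ?mem_A1 ?mem_A2.
Qed.

Lemma Delta0_ddlemma : (forall k, Delta A k = 0) -> ddlemma A.
Proof.
move=> D0; apply/ddlemmaE => p q x xp d1x d2x.
have xk := part_total erefl xp; move: (p + q) xk => k xk.
move=> /(A_boundariesP xk)[y [z [yk zk xE]]].
(* Degeneration and the splitting of K12 are used in degree k - 1, where the primitives live; the
   intersection of images is used in degree k. *)
have [deg1 deg2 _ split_k] := Delta_eq0 (D0 (k - 1)).
have [_ _ cap_k _] := Delta_eq0 (D0 k).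
have /split_k/addSP[z1 [z2 [/K1P[z1k d1z1] /K2P[_ d2z2] zE]]] : z \in K12 (k - 1).
  apply/K12P; split=> //.
  by rewrite -[d2 z](addKr (d1 y)) -xE linearD linearN del1_del1 d1x oppr0 addr0.
have /split_k/addSP[y1 [y2 [/K1P[_ d1y1] /K2P[y2k d2y2] yE]]] : y \in K12 (k - 1).
  apply/K12P; split=> //; rewrite -[d1 _]opprK -d2d1.
  by rewrite -[d1 y](addrK (d2 z)) -xE linearB /= del2_del2 d2x subr0 oppr0.
(* The parts [y1] in ker d1 and [z2] in ker d2 do not contribute to [x]. *)
have xE' : x = d1 y2 + d2 z1.
  by rewrite xE yE zE !linearD d1y1 d2z2 add0r addr0.
have [w wE] := deg2 _ y2k d2y2; have [w' w'E] := deg1 _ z1k d1z1.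
rewrite xE' rpredD //.
  have /cap_k/andP[] // : d1 y2 \in capS (I1 k) (I2 k).
  by rewrite mem_capS !mem_capS (d1_total y2k) mem_im1 wE mem_im2.
have /cap_k/andP[] // : d2 z1 \in capS (I1 k) (I2 k).
by rewrite mem_capS !mem_capS (d2_total z1k) mem_im2 w'E mem_im1.
Qed.

Lemma ddlemma_Delta0 : ddlemma A -> forall k, Delta A k = 0.
Proof.
move=> /ddlemma_totalP dd k; apply/eqP; rewrite eq_le Delta_ge0 andbT.
have [f1 _ _ _ _] := varouchas_count_total k.
have [fdR _ _] := K1_froelicher f1.
(* The d1- and d2-closed elements modulo total boundaries embed in H_dR. *)
have [fBC leBC] : fin (capS (K1 k) (K2 k)) (dR_boundaries A k) /\
    (dq (capS (K1 k) (K2 k)) (dR_boundaries A k) <=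
     dq (dR_cycles A k) (dR_boundaries A k))%N.
  apply: dq_le => // x /andP[/K1P[xk d1x] /K2P[_ d2x]].
  by exists x; rewrite ?subrr ?rpred0 // mem_capS mem_kerS xk /= d1x d2x addr0 eqxx.
have [_ leBC'] : fin (capS (K1 k) (K2 k)) (I12 k) /\
    (dq (capS (K1 k) (K2 k)) (I12 k) <=
     dq (capS (K1 k) (K2 k)) (dR_boundaries A k))%N.
  (* A closed [x] that is a total boundary lies in im d1 + im d2, hence in im d1 d2 by the lemma:
     H_BC maps injectively to H_dR. *)
  apply: dq_le => // [x xZ|x /andP[/K1P[xk d1x] /K2P[_ d2x]] /imSP[y _ xE]].
    by exists x; rewrite ?subrr ?rpred0.
  by rewrite mem_capS xk dd // xE rpredD ?mem_A1 ?mem_A2.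
have [_ leA] : fin (K12 k) (addS (I1 k) (I2 k)) /\
    (dq (K12 k) (addS (I1 k) (I2 k)) <= dq (dR_cycles A k) (dR_boundaries A k))%N.
  apply: dq_le => // [x /K12P[xk d12x]|x /andP[xk _] /imSP[y yk ->]].
    have /imSP[w _ wE] : d1 x \in BC_boundaries A.
      by apply: dd; rewrite ?del1_del1 ?mem_A1 // d2d1 d12x oppr0.
    have /imSP[v _ vE] : d2 x \in BC_boundaries A.
      by apply: dd; rewrite ?del2_del2 ?mem_A2.
    (* Since d1 x = d1 d2 w and d2 x = d1 d2 v, this correction by Aeppli boundaries is closed under
       both differentials. It shows that H_dR maps onto H_A. *)
    pose x' := x - d2 w + d1 v.
    have d1x' : d1 x' = 0 by rewrite linearD linearB del1_del1 wE subrr addr0.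
    have d2x' : d2 x' = 0.
      by rewrite linearD linearB del2_del2 vE subr0 d2d1 subrr.
    have kk : k + 1 - 1 = k by rewrite addrK.
    (* The degrees of [w] and [v] are not controlled, so [x'] is projected to degree k. *)
    exists (tot k x').
      rewrite mem_capS mem_kerS tot_in /= -{1 2}kk -tot_d1 -tot_d2 d1x' d2x'.
      by rewrite linear0 addr0 eqxx.
    rewrite /x' -{1}(tot_id xk) -linearB !opprD opprK !addrA subrr add0r.
    rewrite linearB tot_d1 tot_d2 rpredD ?memN //.
      by apply: addS_subr; rewrite mem_capS mem_im2 d2_total ?tot_in.
    by apply: addS_subl; rewrite mem_capS mem_im1 d1_total ?tot_in.
  apply: rpredD; [apply: addS_subl|apply: addS_subr].
    by rewrite mem_capS mem_im1 d1_total.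
  by rewrite mem_capS mem_im2 d2_total.
rewrite Delta_count // -[Defs.dim (H_dR A k)]/(dq _ _); lia.
Qed.

End Components.

Theorem theorem9 (K : fieldType) (A : double_complex K)
  (bA : bounded A)
  (finBC : forall p q : int, fin_dim (H_BC A p q))
  (finA : forall p q : int, fin_dim (H_A A p q)) :
  (forall k : int, 0 <= Delta A k) /\
  ((forall k : int, Delta A k = 0) <-> ddlemma A).
Proof.
have /finite_seqP[s sE] := bA.
have supp (pq : int * int) (x : A) :
    x \in part A pq.1 pq.2 -> pq \notin undup s -> x = 0.
  move=> xp; rewrite mem_undup; apply: contraNeq => x0.
  have : [set r : int * int |
      exists2 y : A, y \in part A r.1 r.2 & y != 0]%classic pq by exists x.
  by rewrite sE.
(* The successor makes the upper bounds of the box strict. *)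
pose N := (\max_(pq <- s) maxn (absz pq.1) (absz pq.2)).+1%N.
have box pq : pq \in undup s ->
    [/\ - N%:Z <= pq.1, pq.1 < N%:Z, - N%:Z <= pq.2 & pq.2 < N%:Z].
  rewrite mem_undup => pqs.
  have : (maxn (absz pq.1) (absz pq.2) < N)%N.
    by rewrite ltnS (@leq_bigmax_seq _ s xpredT (fun r => maxn (absz r.1) (absz r.2))).
  by rewrite gtn_max => /andP[? ?]; split; lia.
have us := undup_uniq s.
split; first exact: (Delta_ge0 us supp box finBC finA).
split; first exact: (Delta0_ddlemma us supp box finBC finA).
exact: (ddlemma_Delta0 us supp box finBC finA).
Qed.
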